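(* Let $\bm{C}_1,\bm{C}_2\subset\mathbb{P}^3(\mathbb{R})$ be two rational algebraic curves properly parametrized by homogeneous parametrizations $\bm{p},\bm{q}$ of the same degree $n\ge4$, satisfying hypotheses (i)-(iv) listed in the context, and let $G(t_0,t_1,u,v)=\gcd(E_1,E_2)$ be the polynomial defined in the context. If $\bm{C}_1$ and $\bm{C}_2$ are projectively equivalent, then there exists a Möbius-like factor $F$, i.e. a polynomial $$F(t_0,t_1,u,v)=u(ct_0+dt_1)-v(at_0+bt_1),\qquad a,b,c,d\in\mathbb{R},\ ad-bc\neq0,$$ such that $F$ divides $G$.
   Context: A curve $\bm{C}\subset\mathbb{P}^3(\mathbb{R})$ is given by a homogeneous parametrization $\bm{p}:\mathbb{P}^1(\mathbb{R})\to\bm{C}$, $\bm{p}(t_0,t_1)=(p_0,p_1,p_2,p_3)$ (a column vector), whose components are real homogeneous polynomials of degree $n$ in $t_0,t_1$. Hypotheses on $\bm{p},\bm{q}$: (i) $\bm{p}$ and $\bm{q}$ are proper, i.e. birational onto $\bm{C}_1$, $\bm{C}_2$ (almost all points of each curve are reached); (ii) $\gcd(p_0,p_1,p_2,p_3)=\gcd(q_0,q_1,q_2,q_3)=1$; (iii) $\bm{p}$ and $\bm{q}$ have the same degree $n\ge 4$; (iv) neither curve is contained in a hyperplane (so the $4\times(n+1)$ coefficient matrices have rank 4). A projectivity is a map $f:\mathbb{P}^3(\mathbb{R})\to\mathbb{P}^3(\mathbb{R})$, $f(\bm{x})=M\cdot\bm{x}$, with $M$ a non-singular real $4\times4$ matrix.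 $\bm{C}_1,\bm{C}_2$ are projectively equivalent if there is a projectivity $f$ with $f(\bm{C}_1)=\bm{C}_2$. Notation: $\bm{u}_{t_0^kt_1^l}=\partial^{k+l}\bm{u}/\partial t_0^k\partial t_1^l$; $\Vert\bm{w}_1\,\ldots\,\bm{w}_4\Vert$ is the determinant of the matrix with columns $\bm{w}_i$. Put $$\Delta(\bm{u})=\Vert \bm{u}_{t_0}\,\bm{u}_{t_1}\,\bm{u}_{t_0^2}\,\bm{u}_{t_0^3}\Vert,\quad A_1(\bm{u})=\Vert \bm{u}_{t_0^4}\,\bm{u}_{t_1}\,\bm{u}_{t_0^2}\,\bm{u}_{t_0^3}\Vert,\quad A_2(\bm{u})=\Vert \bm{u}_{t_0}\,\bm{u}_{t_0^4}\,\bm{u}_{t_0^2}\,\bm{u}_{t_0^3}\Vert,$$ $$A_3(\bm{u})=\Vert \bm{u}_{t_0}\,\bm{u}_{t_1}\,\bm{u}_{t_0^4}\,\bm{u}_{t_0^3}\Vert,\quad A_4(\bm{u})=\Vert \bm{u}_{t_0}\,\bm{u}_{t_1}\,\bm{u}_{t_0^2}\,\bm{u}_{t_0^4}\Vert,$$ $I_i(\bm{u})=A_i(\bm{u})/\Delta(\bm{u})$ for $i=1,2,3,4$, and $I_0(\bm{u})=t_1I_1(\bm{u})-t_0I_2(\bm{u})$. The projective curvatures are the rational functions of $(t_0,t_1)$ $$\kappa_1(\bm{u})=\frac{\left(8(n-3)^2I_0+4(n-1)(n-3)t_1I_3I_4+(n-1)(n-2)t_1I_4^3\right)^2}{t_1^2\left(8(n-3)I_3+3(n-2)I_4^2\right)^3},$$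 $$\kappa_2(\bm{u})=\frac{256(n-3)^3I_2+64(n-3)^2I_0I_4+16(n-1)(n-3)t_1I_3I_4^2+3(n-1)(n-2)t_1I_4^4}{t_1\left(8(n-3)I_3+3(n-2)I_4^2\right)^2},$$ where $I_j=I_j(\bm{u})$. Write in lowest terms $$\kappa_1(\bm{p})=\frac{U(t_0,t_1)}{V(t_0,t_1)},\quad \kappa_2(\bm{p})=\frac{Y(t_0,t_1)}{Z(t_0,t_1)},\quad \kappa_1(\bm{q})=\frac{\bar U(t_0,t_1)}{\bar V(t_0,t_1)},\quad \kappa_2(\bm{q})=\frac{\bar Y(t_0,t_1)}{\bar Z(t_0,t_1)},$$ with homogeneous polynomials satisfying $\gcd(U,V)=\gcd(Y,Z)=\gcd(\bar U,\bar V)=\gcd(\bar Y,\bar Z)=1$. With $u,v$ new independent variables define $$E_1(t_0,t_1,u,v)=U(t_0,t_1)\bar V(u,v)-V(t_0,t_1)\bar U(u,v),\qquad E_2(t_0,t_1,u,v)=Y(t_0,t_1)\bar Z(u,v)-Z(t_0,t_1)\bar Y(u,v),$$ and $G=\gcd(E_1,E_2)$. *)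

(* Defs.v *)
From HB Require Import structures.
From mathcomp Require Import all_boot all_order all_algebra.
From mathcomp Require Import mpoly.
From mathcomp Require Import reals.

Set Implicit Arguments.
Unset Strict Implicit.
Unset Printing Implicit Defensive.

Import GRing.Theory Num.Theory.
Local Open Scope ring_scope.

Section Divisibility.
Variables (R : idomainType) (m : nat).
Implicit Types (f g d : {mpoly R[m]}) (s : seq {mpoly R[m]}).

Definition mdvd d f : Prop := exists k, f = k * d.

(* A gcd is determined only up to a unit of R, hence a relation:
   [is_gcd s 1] says that the members of [s] are coprime. *)
Definition is_gcd s g : Prop :=
  (forall f, f \in s -> mdvd g f) /\
  (forall d, (forall f, f \in s -> mdvd d f) -> mdvd d g).

End Divisibility.

(* A point of P^(m-1)(R) is given by the nonzero column vectors of its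
   homogeneous coordinates, and a subset of P^(m-1)(R) by the set of all
   homogeneous coordinate vectors of its points. *)
Section Projective.
Variable R : realType.

Definition same_point m (x y : 'cV[R]_m) : Prop :=
  exists2 k : R, k != 0 & y = k *: x.

Definition cveval m (h : {mpoly R[m]}) (x : 'cV[R]_m) : R :=
  h.@[fun i => x i 0].

Definition peval k m (p : 'cV[{mpoly R[k]}]_m) (t : 'cV[R]_k) : 'cV[R]_m :=
  \col_i cveval (p i 0) t.

Definition pcomp (h : {mpoly R[4]}) (p : 'cV[{mpoly R[2]}]_4) : {mpoly R[2]} :=
  h \mPo [tuple p i 0 | i < 4].

Definition image_curve (p : 'cV[{mpoly R[2]}]_4) (x : 'cV[R]_4) : Prop :=
  x != 0 /\ exists2 t : 'cV[R]_2, t != 0 & same_point x (peval p t).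

Definition zariski_closure (S : 'cV[R]_4 -> Prop) (x : 'cV[R]_4) : Prop :=
  x != 0 /\
  forall (d : nat) (h : {mpoly R[4]}), h \is d.-homog ->
    (forall y, S y -> cveval h y = 0) -> cveval h x = 0.

(* The components may be zero polynomials, which are homogeneous of every
   degree. *)
Definition homogeneous_param (n : nat) (p : 'cV[{mpoly R[2]}]_4) : Prop :=
  forall i, p i 0 \is n.-homog.

(* [p] is birational from P^1 onto the curve [C]: the image of [p] is dense in
   [C], and [p] has a rational inverse h = (h_0 : h_1) on [C], not identically
   (0 : 0) there.  [C] is the Zariski closure and not just the image, since
   finitely many real points of [C] may come from conjugate complex
   parameters. *)
Definition birational_onto (p : 'cV[{mpoly R[2]}]_4) (C : 'cV[R]_4 -> Prop) :
    Prop :=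
  (forall x, C x <-> zariski_closure (image_curve p) x) /\
  exists (d : nat) (h : 'cV[{mpoly R[4]}]_2),
    [/\ forall i, h i 0 \is d.-homog,
        exists i, pcomp (h i 0) p != 0,
        'X_1 * pcomp (h 0 0) p = 'X_0 * pcomp (h 1 0) p
      & forall x, C x -> peval h x != 0 -> same_point x (peval p (peval h x))].

Definition in_hyperplane (C : 'cV[R]_4 -> Prop) : Prop :=
  exists2 a : 'rV[R]_4, a != 0 & forall x, C x -> a *m x = 0.

Definition projectively_equivalent (C1 C2 : 'cV[R]_4 -> Prop) : Prop :=
  exists2 M : 'M[R]_4, M \in unitmx &
    forall y, C2 y <-> exists2 x, C1 x & y = M *m x.

End Projective.

Section Curvatures.
Variable R : realType.
Implicit Types (w u : 'cV[{mpoly R[2]}]_4).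

Local Notation rfun := {fraction {mpoly R[2]}}.

(* u_{t0^k t1^l} *)
Definition pderiv u (k l : nat) : 'cV[{mpoly R[2]}]_4 :=
  map_mx (fun f => iter k (mderiv 0) (iter l (mderiv 1) f)) u.

Definition det4 w1 w2 w3 w4 : {mpoly R[2]} :=
  \det (\matrix_(i < 4, j < 4) nth 0 [:: w1; w2; w3; w4] j i 0).

Definition Delta u :=
  det4 (pderiv u 1 0) (pderiv u 0 1) (pderiv u 2 0) (pderiv u 3 0).
Definition A1 u :=
  det4 (pderiv u 4 0) (pderiv u 0 1) (pderiv u 2 0) (pderiv u 3 0).
Definition A2 u :=
  det4 (pderiv u 1 0) (pderiv u 4 0) (pderiv u 2 0) (pderiv u 3 0).
Definition A3 u :=
  det4 (pderiv u 1 0) (pderiv u 0 1) (pderiv u 4 0) (pderiv u 3 0).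
Definition A4 u :=
  det4 (pderiv u 1 0) (pderiv u 0 1) (pderiv u 2 0) (pderiv u 4 0).

Definition t0 : rfun := tofrac 'X_0.
Definition t1 : rfun := tofrac 'X_1.

Definition I1 u : rfun := tofrac (A1 u) / tofrac (Delta u).
Definition I2 u : rfun := tofrac (A2 u) / tofrac (Delta u).
Definition I3 u : rfun := tofrac (A3 u) / tofrac (Delta u).
Definition I4 u : rfun := tofrac (A4 u) / tofrac (Delta u).
Definition I0 u : rfun := t1 * I1 u - t0 * I2 u.

(* The subtractions below are in the ring, not truncated ones on [nat].
   A curvature whose denominator vanishes identically gets the value 0, because
   x / 0 = 0 in a fraction field. *)
Definition kappa1 (n : nat) u : rfun :=
  let N : rfun := n%:R in
  (8 * (N - 3) ^+ 2 * I0 u + 4 * (N - 1) * (N - 3) * t1 * I3 u * I4 u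
     + (N - 1) * (N - 2) * t1 * I4 u ^+ 3) ^+ 2
  / (t1 ^+ 2 * (8 * (N - 3) * I3 u + 3 * (N - 2) * I4 u ^+ 2) ^+ 3).

Definition kappa2 (n : nat) u : rfun :=
  let N : rfun := n%:R in
  (256 * (N - 3) ^+ 3 * I2 u + 64 * (N - 3) ^+ 2 * I0 u * I4 u
     + 16 * (N - 1) * (N - 3) * t1 * I3 u * I4 u ^+ 2
     + 3 * (N - 1) * (N - 2) * t1 * I4 u ^+ 4)
  / (t1 * (8 * (N - 3) * I3 u + 3 * (N - 2) * I4 u ^+ 2) ^+ 2).

Definition lowest_terms (k : rfun) (U V : {mpoly R[2]}) : Prop :=
  [/\ exists d, U \is d.-homog, exists d, V \is d.-homog,
      V != 0, is_gcd [:: U; V] 1 & k = tofrac U / tofrac V].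

End Curvatures.

(* In the four variables (t0, t1, u, v) = ('X_0, 'X_1, 'X_2, 'X_3). *)
Section FourVariables.
Variable R : realType.

Definition in_t (f : {mpoly R[2]}) : {mpoly R[4]} := f \mPo [tuple 'X_0; 'X_1].
Definition in_uv (f : {mpoly R[2]}) : {mpoly R[4]} := f \mPo [tuple 'X_2; 'X_3].

Definition E_poly (U V Ub Vb : {mpoly R[2]}) : {mpoly R[4]} :=
  in_t U * in_uv Vb - in_t V * in_uv Ub.

Definition mobius_like (a b c d : R) : {mpoly R[4]} :=
  'X_2 * (c *: 'X_0 + d *: 'X_1) - 'X_3 * (a *: 'X_0 + b *: 'X_1).

End FourVariables.

(* Main.v *)
From HB Require Import structures.
Require Import Defs.
From mathcomp Require Import all_boot all_order all_algebra.
From mathcomp Require Import mpoly.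
From mathcomp Require Import reals.
From mathcomp Require Import ring zify.

Set Implicit Arguments.
Unset Strict Implicit.
Unset Printing Implicit Defensive.

Import GRing.Theory Num.Theory.
Local Open Scope ring_scope.

(** Let M be a projectivity from C1 to C2.  The rational inverse of q, applied to
M p(t), yields a pair A(t) of polynomials such that M p(t) and q(A(t)) are
proportional.  After division by the gcd of A, the pair A consists of coprime
forms of some degree e, and the forms q_i(A), of degree n e, are coprime again,
as are the components of M p, of degree n.  Proportional families of coprime
forms differ by a constant, hence n = n e and e = 1: the two parametrizations
are related by M p = lam q(phi), where phi = (a t0 + b t1, c t0 + d t1) is
linear and invertible.  This is [reparametrization_of_equivalence]; its
algebraic core is [reparametrization_mobius].

The curvatures do not see M and lam, because I_1, ..., I_4 are the coordinates
of the fourth derivative in the frame (u_t0, u_t1, u_t0^2, u_t0^3), by Cramer's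
rule, and these coordinates are invariant under linear maps ([kappa_mulmx]).
Under t -> phi(t), Euler's relation expresses all derivatives of q(phi) in terms
of q_v and of derivatives of q in its first parameter u alone, and so gives the
new coordinates from the old ones ([iter_mderiv_linsubst], [jet_coords]).  The
combinations kappa_1 and kappa_2 of the coordinates are those which the change
leaves alone ([curvature1_moved], [curvature2_moved]), so
kappa_i(q(phi)) = kappa_i(q)(phi), which is [kappa_linsubst].

Therefore kappa_i(p)(t) = kappa_i(q)(phi(t)): the polynomials E_1 and E_2 vanish
when (u, v) is replaced by phi(t).  They are homogeneous in (u, v), as the
curvatures have degree 0, and such a polynomial is divisible by
F = u (c t0 + d t1) - v (a t0 + b t1), see [mobius_dvd].
Hence F divides both of them, and their gcd G. *)

(** * Substitution in multivariate polynomials *)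

Section MPolyBasics.
Variables (R : comRingType) (n : nat).
Implicit Types f g : {mpoly R[n]}.

(** Reduces the comparison of two morphisms, or of two derivations, to constants
and variables. *)
Lemma mpoly_algebra_ind (P : {mpoly R[n]} -> Prop) :
    (forall c, P c%:MP) -> (forall i, P 'X_i) ->
    (forall f g, P f -> P g -> P (f + g)) ->
    (forall f g, P f -> P g -> P (f * g)) ->
  forall f, P f.
Proof.
move=> PC PX PD PM; elim/mpolyind=> [|c m f _ _ Pf]; first exact: (PC 0).
apply: (PD) Pf; rewrite -mul_mpolyC; apply: (PM) => //.
rewrite mpolyXE_id; apply: (big_ind P); [exact: (PC 1) | exact: PM | move=> i _].
elim: (m i) => [|k IH]; [exact: (PC 1) | by rewrite exprS; apply: PM].
Qed.

Lemma mmap_rmorph (S S' : comRingType) (g : {rmorphism R -> S})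
    (sg : {rmorphism S -> S'}) (h : 'I_n -> S) f :
  sg (mmap g h f) = mmap (sg \o g) (sg \o h) f.
Proof.
elim/mpoly_algebra_ind: f => [c|i|f f' IH IH'|f f' IH IH'].
- by rewrite !mmapC.
- by rewrite !mmapX !mmap1U.
- by rewrite !rmorphD /= IH IH'.
- by rewrite !rmorphM /= IH IH'.
Qed.

Lemma mmap_comp_mpoly k (S : comRingType) (g : {rmorphism R -> S})
    (h : 'I_k -> S) (L : n.-tuple {mpoly R[k]}) f :
  mmap g h (f \mPo L) = mmap g (fun i => mmap g h (tnth L i)) f.
Proof.
elim/mpoly_algebra_ind: f => [c|i|f f' IH IH'|f f' IH IH'].
- by rewrite comp_mpolyC !mmapC.
- by rewrite comp_mpolyXU mmapX mmap1U -tnth_nth.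
- by rewrite !rmorphD /= IH IH'.
- by rewrite !rmorphM /= IH IH'.
Qed.

Lemma mmap_homog (S : comRingType) (g : {rmorphism R -> S}) (h h' : 'I_n -> S)
    z d f : f \is d.-homog -> (forall i, h' i = z * h i) ->
  mmap g h' f = z ^+ d * mmap g h f.
Proof.
move=> /dhomogP df hh'; rewrite /mmap mulr_sumr !big_seq; apply: eq_bigr => m mf.
rewrite mulrCA -(df m mf) /= mdegE; congr (_ * _).
rewrite /mmap1 expr_sum -big_split /=.
by apply: eq_bigr => i _; rewrite hh' exprMn.
Qed.

Lemma mderiv_comp_mpoly k (L : n.-tuple {mpoly R[k]}) i f :
  mderiv i (f \mPo L) = \sum_j (mderiv j f \mPo L) * mderiv i (tnth L j).
Proof.
elim/mpoly_algebra_ind: f => [c|j|f f' IH IH'|f f' IH IH'].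
- rewrite comp_mpolyC mderivC big1 // => j _.
  by rewrite mderivC comp_mpoly0 mul0r.
- rewrite comp_mpolyXU -tnth_nth (bigD1 j) //= big1 ?addr0.
    rewrite mderivX mnm1E eqxx scale1r -{1}[U_(j)%MM]add0m addmK mpolyX0.
    by rewrite comp_mpoly1 mul1r.
  by move=> l jl; rewrite mderivX mnm1E eq_sym (negbTE jl) scale0r comp_mpoly0 mul0r.
- rewrite comp_mpolyD mderivD IH IH' -big_split; apply: eq_bigr => j _ /=.
  by rewrite mderivD comp_mpolyD mulrDl.
- rewrite rmorphM mderivM IH IH' mulr_suml mulr_sumr -big_split.
  apply: eq_bigr => j _ /=; rewrite mderivM rmorphD !rmorphM /=; ring.
Qed.

Lemma mderiv_euler d f : f \is d.-homog ->
  \sum_i 'X_i * mderiv i f = d%:R * f.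
Proof.
move=> /dhomogP df; rewrite [f in RHS]mpolyE mulr_sumr.
under eq_bigr => i _ do rewrite [f in mderiv i f]mpolyE linear_sum mulr_sumr.
rewrite exchange_big /= !big_seq; apply: eq_bigr => m mf.
rewrite -(df m mf) /= mdegE natr_sum mulr_suml; apply: eq_bigr => i _.
rewrite linearZ /= mderivX -!scalerAr; congr (_ *: _).
have [->|mi] := posnP (m i); first by rewrite scale0r mul0r.
rewrite -mpolyXD addmC submK; first by rewrite scaler_nat mulr_natl.
by rewrite lep1mP -lt0n.
Qed.

Lemma mderiv_homog d i f : f \is d.+1.-homog -> mderiv i f \is d.-homog.
Proof.
move=> df; apply/dhomogP => m; rewrite mcoeff_msupp mcoeff_mderiv => mf.
have : (m + U_(i))%MM \in msupp f.
  by rewrite mcoeff_msupp; apply: contraNneq mf => ->; rewrite mul0rn.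
by move/(dhomog_mf df); rewrite /= mdegD mdeg1 addn1 => -[].
Qed.

End MPolyBasics.

(** Divisibility by a linear form and by the Moebius-like factor are both read off
from two substitutions which agree modulo F. *)
Lemma mmap_congr n (R S : comRingType) (F : S) (g : {rmorphism R -> S})
   (h h' : 'I_n -> S) (f : {mpoly R[n]}) :
  (forall i, exists z, h i - h' i = z * F) ->
  exists z, mmap g h f - mmap g h' f = z * F.
Proof.
move=> Fh; elim/mpoly_algebra_ind: f => [c|i|f f' [z E] [z' E']|f f' [z E] [z' E']].
- by exists 0; rewrite !mmapC subrr mul0r.
- by rewrite !mmapX !mmap1U.
- by exists (z + z'); rewrite !rmorphD /= mulrDl -E -E'; ring.
- exists (z * mmap g h f' + mmap g h' f * z').
  rewrite !rmorphM /= mulrDl mulrAC -E -(mulrA _ z') -E'; ring.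
Qed.

Lemma comp_mpoly_homog (R : comNzRingType) k l d j
    (L : k.-tuple {mpoly R[l]}) (f : {mpoly R[k]}) :
    f \is d.-homog -> (forall i, tnth L i \is j.-homog) ->
  f \mPo L \is (j * d).-homog.
Proof.
move=> /dhomogP fd Lj; rewrite comp_mpolyEX big_seq; apply: rpred_sum => m mf.
rewrite rpredZ // comp_mpolyX -(fd m mf) /= mdegE big_distrr /=.
elim/big_rec2: _ => [|i e g _ gd]; first exact: dhomog1.
by apply: dhomogM => //; apply: dhomogMn.
Qed.

(** * Linear substitutions in two variables *)

Lemma sum_ord2 (V : nmodType) (F : 'I_2 -> V) : \sum_i F i = F 0 + F 1.
Proof. by rewrite big_ord_recl big_ord1; congr (_ + F _); apply: val_inj. Qed.

Lemma ord2_ind (P : 'I_2 -> Prop) : P 0 -> P 1 -> forall i, P i.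
Proof.
move=> P0 P1 [[|[|//]]] lt; first by rewrite (_ : Ordinal lt = 0) //; apply: val_inj.
by rewrite (_ : Ordinal lt = 1) //; apply: val_inj.
Qed.

Definition ord2_fun (T : Type) (x y : T) (i : 'I_2) := if i == 0 then x else y.

Section LinearSubstitution.
Variable R : fieldType.
Implicit Types (a b c d : R) (f : {mpoly R[2]}).

Definition linform a b : {mpoly R[2]} := a *: 'X_0 + b *: 'X_1.
Definition linsubst a b c d : 2.-tuple {mpoly R[2]} := [tuple linform a b; linform c d].

Lemma linform_comp k a b (L : 2.-tuple {mpoly R[k]}) :
  linform a b \mPo L = a *: tnth L 0 + b *: tnth L 1.
Proof. by rewrite comp_mpolyD !comp_mpolyZ !comp_mpolyXU !(tnth_nth 0). Qed.

(** The inverse matrix yields an inverse substitution. *)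
Lemma linsubst_inj a b c d : a * d - b * c != 0 ->
  injective (comp_mpoly (linsubst a b c d)).
Proof.
set e := a * d - b * c => e0.
pose L' := linsubst (d / e) (- b / e) (- c / e) (a / e).
apply: (can_inj (g := comp_mpoly L')) => f.
rewrite /comp_mpoly mmap_comp_mpoly -[RHS]comp_mpoly_id.
apply: eq_bigr => m _; congr (_ * _); apply: mmap1_eq => i.
rewrite tnth_mktuple -/(comp_mpoly _ _).
case: i => [[|[|//]]] ilt; rewrite (tnth_nth 0) linform_comp /tnth /=.
  rewrite /linform !scalerDr !scalerA addrACA -!scalerDl.
  have -> : a * (d / e) + b * (- c / e) = 1 by rewrite /e; field.
  have -> : a * (- b / e) + b * (a / e) = 0 by rewrite /e; field.
  by rewrite scale1r scale0r addr0; congr 'X_(_); apply: val_inj.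
rewrite /linform !scalerDr !scalerA addrACA -!scalerDl.
have -> : c * (d / e) + d * (- c / e) = 0 by rewrite /e; field.
have -> : c * (- b / e) + d * (a / e) = 1 by rewrite /e; field.
by rewrite scale1r scale0r add0r; congr 'X_(_); apply: val_inj.
Qed.

Lemma mderiv_linform i a b : mderiv i (linform a b) = (if i == 0 then a else b)%:MP.
Proof.
rewrite mderivD !mderivZ !mderivX !mnm1E.
elim/ord2_ind: i => /=; rewrite ?scale0r ?scaler0 ?addr0 ?add0r ?scale1r.
  by rewrite -{1}[U_(0%R)%MM]add0m addmK mpolyX0 alg_mpolyC.
by rewrite -{1}[U_(1%R)%MM]add0m addmK mpolyX0 alg_mpolyC.
Qed.

Variables a b c d : R.
Local Notation T := (comp_mpoly (linsubst a b c d)).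
Local Notation e := (a * d - b * c).

Lemma mderiv_linsubst0 f :
  mderiv 0 (T f) = T (a *: mderiv 0 f + c *: mderiv 1 f).
Proof.
rewrite mderiv_comp_mpoly sum_ord2.
rewrite rmorphD /= !comp_mpolyZ.
by rewrite !(tnth_nth 0) /= !mderiv_linform /= ![_ * _%:MP]mulrC !mul_mpolyC.
Qed.

Lemma mderiv_linsubst1 f :
  mderiv 1 (T f) = T (b *: mderiv 0 f + d *: mderiv 1 f).
Proof.
rewrite mderiv_comp_mpoly sum_ord2.
rewrite rmorphD /= !comp_mpolyZ.
by rewrite !(tnth_nth 0) /= !mderiv_linform /= ![_ * _%:MP]mulrC !mul_mpolyC.
Qed.

(** For k = 0: the derivation d/dt0 acts on T f through a f_u + c f_v, and Euler's
relation u f_u + v f_v = deg(f) f turns v (a f_u + c f_v) into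
(a v - c u) f_u + c deg(f) f.  After T, a v - c u becomes e t1.  The step from k
to k + 1 applies the case k to a f_u + c f_v, which is homogeneous of one degree
less. *)
Lemma iter_mderiv_linsubst k j f : f \is (k + j).-homog ->
  linform c d * iter k.+1 (mderiv 0) (T f) =
  e *: ('X_1 * iter k (mderiv 0) (T (mderiv 0 f)))
  + (c * j%:R) *: iter k (mderiv 0) (T f).
Proof.
elim: k f => [|k IH] f df; last first.
  pose g := a *: mderiv 0 f + c *: mderiv 1 f.
  have dg : g \is (k + j).-homog by rewrite rpredD // rpredZ // mderiv_homog.
  have := IH g dg; rewrite -mderiv_linsubst0 -iterSr => ->.
  rewrite -!iterSr; congr (_ *: (_ * _) + _).
  rewrite iterSr mderiv_linsubst0; congr (iter _ _ (T _)).
  by rewrite /g mderivD !mderivZ (mderiv_comm 1 0).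
rewrite /= mderiv_linsubst0.
have := mderiv_euler df; rewrite sum_ord2 => eul.
have {eul}E : linform a b * T (mderiv 0 f) + linform c d * T (mderiv 1 f) = j%:R *: T f.
  have := congr1 T eul; rewrite rmorphD !rmorphM /= !comp_mpolyXU /= => ->.
  by rewrite rmorph_nat scaler_nat mulr_natl.
rewrite rmorphD /= !comp_mpolyZ -scalerA -E.
move: (T _) (T _) => x y; rewrite /linform -!mul_mpolyC mpolyCB !mpolyCM.
move: ('X_0 : {mpoly R[2]}) ('X_1 : {mpoly R[2]}) => X0 X1.
move: (a%:MP) (b%:MP) (c%:MP) (d%:MP) => a' b' c' d'; ring.
Qed.
End LinearSubstitution.

(** * Binary forms and univariate polynomials *)

Section Binary.
Variable R : fieldType.
Implicit Types (f g : {mpoly R[2]}) (B P Q : {poly R}).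

Definition subst_pair B0 B1 : {mpoly R[2]} -> {poly R} :=
  mmap (@polyC R) (ord2_fun B0 B1).

HB.instance Definition _ B0 B1 := GRing.RMorphism.on (subst_pair B0 B1).

Lemma subst_pairC B0 B1 c : subst_pair B0 B1 c%:MP = c%:P.
Proof. exact: mmapC. Qed.

Lemma subst_pairX B0 B1 i : subst_pair B0 B1 'X_i = ord2_fun B0 B1 i.
Proof. by rewrite /subst_pair mmapX mmap1U. Qed.

Lemma subst_pairZ B0 B1 c f : subst_pair B0 B1 (c *: f) = c *: subst_pair B0 B1 f.
Proof. by rewrite -mul_mpolyC rmorphM /= subst_pairC mul_polyC. Qed.

Lemma subst_pair_comp B0 B1 (L : 2.-tuple {mpoly R[2]}) f :
  subst_pair B0 B1 (f \mPo L) =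
  subst_pair (subst_pair B0 B1 (tnth L 0)) (subst_pair B0 B1 (tnth L 1)) f.
Proof.
rewrite /subst_pair mmap_comp_mpoly; apply: eq_bigr => m _; congr (_ * _).
by apply: mmap1_eq; elim/ord2_ind.
Qed.

Lemma horner_subst_pair B0 B1 x f :
  (subst_pair B0 B1 f).[x] = f.@[ord2_fun B0.[x] B1.[x]].
Proof.
rewrite -horner_evalE /subst_pair mmap_rmorph /meval /mmap.
apply: eq_bigr => m _ /=; rewrite horner_evalE hornerC; congr (_ * _).
by apply: mmap1_eq; elim/ord2_ind; rewrite /= horner_evalE.
Qed.

Lemma subst_pair_homog B0 B1 z n f : f \is n.-homog ->
  subst_pair (z * B0) (z * B1) f = z ^+ n * subst_pair B0 B1 f.
Proof. by move=> fn; apply: mmap_homog fn _; elim/ord2_ind. Qed.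

(** The affine chart X_1 = 1; only the point (1 : 0) is missing. *)
Definition dehom := subst_pair 'X 1.

Lemma dehom0 : dehom 0 = 0. Proof. exact: rmorph0. Qed.

Definition homogenize k P : {mpoly R[2]} :=
  \sum_(i < k.+1) P`_i *: ('X_0 ^+ i * 'X_1 ^+ (k - i)).

Lemma homogenize_is_linear k : linear (homogenize k).
Proof.
move=> c P Q; rewrite /homogenize scaler_sumr -big_split; apply: eq_bigr => i _ /=.
by rewrite coefD coefZ scalerDl scalerA.
Qed.

HB.instance Definition _ k :=
  GRing.isLinear.Build R {poly R} {mpoly R[2]} *:%R (homogenize k)
    (homogenize_is_linear k).

Lemma homogenize_homog k P : homogenize k P \is k.-homog.
Proof.
have Xj j i : ('X_j ^+ i : {mpoly R[2]}) \is i.-homog.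
  by rewrite -{2}[i]mul1n dhomogMn // dhomogX /= mdeg1.
apply: rpred_sum => i _; apply: rpredZ.
by have := dhomogM (Xj 0 i) (Xj 1 (k - i)%N); rewrite subnKC ?leq_ord.
Qed.

Lemma homogenizeK k P : (size P <= k.+1)%N -> dehom (homogenize k P) = P.
Proof.
move=> sP; have PE : P = \poly_(i < k.+1) P`_i.
  apply/polyP=> i; rewrite coef_poly; case: ltnP => // ki.
  by rewrite nth_default // (leq_trans sP).
rewrite [RHS]PE poly_def /dehom rmorph_sum; apply: eq_bigr => i _ /=.
rewrite subst_pairZ rmorphM !rmorphXn /= !subst_pairX /=.
by rewrite expr1n mulr1.
Qed.

Lemma homogenizeXn k i : (i <= k)%N -> homogenize k 'X^i = 'X_0 ^+ i * 'X_1 ^+ (k - i).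
Proof.
rewrite -ltnS => ik; rewrite /homogenize (bigD1 (Ordinal ik)) //= coefXn eqxx scale1r.
rewrite big1 ?addr0 // => j; rewrite -val_eqE coefXn /= => /negbTE->.
by rewrite scale0r.
Qed.

Lemma dehomK k f : f \is k.-homog -> homogenize k (dehom f) = f.
Proof.
move=> /dhomogP fk; rewrite [f in RHS]mpolyE [f in dehom f]mpolyE.
rewrite /dehom rmorph_sum linear_sum /= !big_seq; apply: eq_bigr => m mf.
rewrite subst_pairZ linearZ /=; congr (_ *: _).
have mk : k = (m 0%R + m 1%R)%N.
  by rewrite -(fk m mf) /= mdegE sum_ord2.
rewrite mpolyXE_id big_ord_recl big_ord1 (_ : lift _ _ = 1); last exact: val_inj.
rewrite rmorphM !rmorphXn /= !subst_pairX /= expr1n mulr1 homogenizeXn mk ?leq_addr //.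
by rewrite addKn.
Qed.

Lemma dehom_inj k f g : f \is k.-homog -> g \is k.-homog -> dehom f = dehom g -> f = g.
Proof. by move=> fk gk E; rewrite -(dehomK fk) -(dehomK gk) E. Qed.

(** Two forms of degree k + l with the same dehomogenization are equal. *)
Lemma homogenizeM k l P Q : (size P <= k.+1)%N -> (size Q <= l.+1)%N ->
  homogenize (k + l) (P * Q) = homogenize k P * homogenize l Q.
Proof.
move=> sP sQ; rewrite -[RHS](@dehomK (k + l)).
  by rewrite /dehom rmorphM /= -!/(dehom _) !homogenizeK.
by apply: dhomogM; apply: homogenize_homog.
Qed.

Lemma size_dehom k f : f \is k.-homog -> (size (dehom f) <= k.+1)%N.
Proof.
move=> /dhomogP fk; rewrite [f]mpolyE /dehom rmorph_sum big_seq.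
apply: (big_ind (fun P => size P <= k.+1)%N); first by rewrite size_poly0.
  by move=> P Q sP sQ; rewrite (leq_trans (size_polyD _ _)) // geq_max sP.
move=> m mf; rewrite /= subst_pairZ mpolyXE_id big_ord_recl big_ord1.
rewrite (_ : lift _ _ = 1); last exact: val_inj.
rewrite rmorphM !rmorphXn /= !subst_pairX /= expr1n mulr1.
rewrite (leq_trans (size_scale_leq _ _)) // size_polyXn ltnS -(fk m mf) /= mdegE.
by rewrite (bigD1 0%R) //= leq_addr.
Qed.

(** The top coefficient, which may vanish, is the value at the point missing from
the chart. *)
Lemma coef_dehom k f : f \is k.-homog -> (dehom f)`_k = f.@[ord2_fun 1 0].
Proof.
move=> fk; rewrite -[f in RHS](dehomK fk) /homogenize big_ord_recr /= rmorphD /=.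
rewrite mevalZ subnn mulr1 rmorphXn /= mevalXU expr1n mulr1.
rewrite rmorph_sum big1 ?add0r // => i _.
rewrite /= mevalZ rmorphM !rmorphXn /= !mevalXU /ord2_fun /=.
rewrite expr0n subn_eq0 leqNgt ltn_ord /=.
by rewrite !mulr0.
Qed.

End Binary.

(** * Coprime families of binary forms *)

Section BinaryBezout.
Variable R : fieldType.

Lemma family_bezout (n : nat) (P : 'I_n -> {poly R}) :
  exists C, forall i, (\sum_j C j * P j : {poly R}) %| P i.
Proof.
elim: n P => [|n IH] P; first by exists (fun=> 0) => -[].
have [C HC] := IH (fun i => P (lift ord0 i)).
set g := \sum_j _ in HC; have [[u v] /= uv] := Bezoutp (P ord0) g.
exists (fun i => if unlift ord0 i is Some j then v * C j else u) => i.
rewrite big_ord_recl unlift_none.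
under eq_bigr => j _ do rewrite liftK -mulrA.
rewrite -mulr_sumr -/g (eqp_dvdl _ uv).
case: (unliftP ord0 i) => [j ->|->]; last exact: dvdp_gcdl.
exact: dvdp_trans (dvdp_gcdr _ _) (HC j).
Qed.

Variables (n m : nat) (p : 'I_m -> {mpoly R[2]}).
Hypotheses (pn : forall i, p i \is n.-homog) (p1 : is_gcd [seq p i | i : 'I_m] 1).

(** A common factor of the dehomogenized forms homogenizes to a common factor of
the forms themselves, so it is constant. *)
Lemma dehom_coprime : exists C, \sum_i C i * dehom (p i) = 1.
Proof.
have [C HC] := family_bezout (fun i => dehom (p i)).
set g := \sum_j _ in HC.
pose D := homogenize (size g).-1 g.
have gD : dehom D = g by rewrite homogenizeK // leqSpred.
have : mdvd D 1.
  apply: (p1.2) => f /imageP[i _ ->].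
  have [->|pi0] := eqVneq (p i) 0; first by exists 0; rewrite mul0r.
  have Pi0 : dehom (p i) != 0.
    by apply: contraNneq pi0 => E; rewrite -(dehomK (pn i)) E linear0.
  have /dvdpP [k kE] := HC i.
  have [k0 g0] : k != 0 /\ g != 0.
    by apply/andP; rewrite -negb_or -mulf_eq0 -kE.
  have := size_dehom (pn i); rewrite kE size_mul // => sz.
  have sg : (0 < size g)%N by rewrite size_poly_gt0.
  have sk : (0 < size k)%N by rewrite size_poly_gt0.
  have gn : ((size g).-1 <= n)%N.
    by move: sz sk sg; move: (size k) (size g) => a b; lia.
  exists (homogenize (n - (size g).-1) k).
  rewrite -homogenizeM ?leqSpred //; last first.
    by move: sz sg; move: (size k) (size g) => a b; lia.
  by rewrite subnK // -kE dehomK.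
move=> [k] /(congr1 (@dehom R)).
rewrite /dehom rmorph1 rmorphM /= -!/(dehom _) gD => gk.
exists (fun i => dehom k * C i); rewrite [RHS]gk /g mulr_sumr.
by apply: eq_bigr => i _; rewrite mulrA.
Qed.

(** Homogenizing a Bezout identity in the chart costs a power of X_1. *)
Lemma bezout_X1 : exists C k, \sum_i C i * p i = 'X_1 ^+ k.
Proof.
have [C C1] := dehom_coprime.
pose K := \max_i size (C i).
exists (fun i => homogenize K (C i)), (K + n)%N.
have -> : 'X_1 ^+ (K + n) = homogenize (K + n) 1 :> {mpoly R[2]}.
  by have := homogenizeXn R (leq0n (K + n)); rewrite !expr0 subn0 mul1r => ->.
rewrite -C1 linear_sum; apply: eq_bigr => i _.
rewrite /= homogenizeM ?dehomK ?size_dehom //.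
by rewrite (leq_trans _ (leqnSn _)) // (leq_bigmax i).
Qed.

End BinaryBezout.

Section Coprimality.
Variable R : fieldType.
Variables (n m : nat) (p : 'I_m -> {mpoly R[2]}).
Hypotheses (pn : forall i, p i \is n.-homog) (p1 : is_gcd [seq p i | i : 'I_m] 1).

(** The other chart: exchange the two variables. *)
Lemma bezout_X0 : exists C k, \sum_i C i * p i = 'X_0 ^+ k.
Proof.
pose s : 2.-tuple {mpoly R[2]} := linsubst 0 1 1 0.
have s0 : tnth s 0 = 'X_1 by rewrite (tnth_nth 0) /= /linform scale0r scale1r add0r.
have s1 : tnth s 1 = 'X_0 by rewrite (tnth_nth 0) /= /linform scale0r scale1r addr0.
have ss f : (f \mPo s) \mPo s = f.
  rewrite /comp_mpoly mmap_comp_mpoly -[RHS]comp_mpoly_id.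
  apply: eq_bigr => j _; congr (_ * _); apply: mmap1_eq => i.
  rewrite tnth_mktuple; elim/ord2_ind: i.
    by rewrite s0 -/(comp_mpoly _ _) comp_mpolyXU -tnth_nth s1.
  by rewrite s1 -/(comp_mpoly _ _) comp_mpolyXU -tnth_nth s0.
have s_homog i : p i \mPo s \is n.-homog.
  rewrite -[n]mul1n; apply: comp_mpoly_homog (pn i) _.
  by elim/ord2_ind; rewrite ?s0 ?s1 dhomogX /= mdeg1.
have [] := @bezout_X1 _ n m (fun i => p i \mPo s) s_homog.
  split=> [f _|D HD]; first by exists f; rewrite mulr1.
  have [|k kE] := p1.2 (D \mPo s).
    move=> f /imageP[i _ ->].
    have [k kE] : mdvd D (p i \mPo s) by apply: HD; apply/imageP; exists i.
    by exists (k \mPo s); rewrite -rmorphM /= -kE ss.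
  by exists (k \mPo s); rewrite -(comp_mpoly1 s) kE rmorphM /= ss.
move=> C [k E]; exists (fun i => C i \mPo s), k.
have := congr1 (comp_mpoly s) E; rewrite rmorphXn /= comp_mpolyXU -tnth_nth s1 => <-.
by rewrite rmorph_sum; apply: eq_bigr => i _; rewrite /= rmorphM /= ss.
Qed.

(** Substituting in the two identities [bezout_X0] and [bezout_X1] shows that the
ideal of the values contains powers of B0 and of B1, which are coprime. *)
Lemma subst_pair_coprime B0 B1 : coprimep B0 B1 ->
  exists C, \sum_i C i * subst_pair B0 B1 (p i) = 1.
Proof.
move=> cop; have [C [k E]] := bezout_X0; have [C' [k' E']] := bezout_X1 pn p1.
have /Bezout_eq1_coprimepP [[u v] /= uv] : coprimep (B0 ^+ k) (B1 ^+ k').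
  by apply: coprimep_expl; apply: coprimep_expr.
exists (fun i => u * subst_pair B0 B1 (C i) + v * subst_pair B0 B1 (C' i)).
rewrite -uv; have <- : subst_pair B0 B1 ('X_0 ^+ k) = B0 ^+ k.
  by rewrite rmorphXn /= subst_pairX.
have <- : subst_pair B0 B1 ('X_1 ^+ k') = B1 ^+ k' by rewrite rmorphXn /= subst_pairX.
rewrite -E -E' !rmorph_sum !mulr_sumr -big_split; apply: eq_bigr => i _ /=.
by rewrite !rmorphM mulrDl !mulrA.
Qed.

Lemma coprime_nonvanishing x y : (x != 0) || (y != 0) ->
  exists i, (p i).@[ord2_fun x y] != 0.
Proof.
move=> xy; case: (pickP (fun i => (p i).@[ord2_fun x y] != 0)) => [i ?|p0].
  by exists i.
have vanish C : (\sum_i C i * p i).@[ord2_fun x y] = 0.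
  rewrite rmorph_sum big1 // => i _; rewrite /= mevalM.
  by move/negbFE/eqP: (p0 i) => ->; rewrite mulr0.
have [C [k E]] := bezout_X0; have [C' [k' E']] := bezout_X1 pn p1.
have := vanish C; rewrite E rmorphXn /= mevalXU /ord2_fun /= => /eqP.
rewrite expf_eq0 => /andP[_ x0].
have := vanish C'; rewrite E' rmorphXn /= mevalXU /ord2_fun /= => /eqP.
rewrite expf_eq0 => /andP[_ y0].
by move: xy; rewrite x0 y0.
Qed.

End Coprimality.

Section TopDegree.
Variable R : fieldType.

(** Both claims are read off from the form of degree e n obtained by substituting
the homogenizations of B0 and B1. *)
Lemma subst_pair_top n e (f : {mpoly R[2]}) (B0 B1 : {poly R}) : f \is n.-homog ->
    (size B0 <= e.+1)%N -> (size B1 <= e.+1)%N ->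
  (size (subst_pair B0 B1 f) <= (e * n).+1)%N /\
  (subst_pair B0 B1 f)`_(e * n) = f.@[ord2_fun B0`_e B1`_e].
Proof.
move=> fn s0 s1; pose L := [tuple homogenize e B0; homogenize e B1].
have Lh : f \mPo L \is (e * n).-homog.
  by apply: comp_mpoly_homog => //; elim/ord2_ind; rewrite (tnth_nth 0) homogenize_homog.
have <- : dehom (f \mPo L) = subst_pair B0 B1 f.
  by rewrite /dehom subst_pair_comp !(tnth_nth 0) /= -!/(dehom _) !homogenizeK.
split; first exact: size_dehom.
rewrite (coef_dehom Lh) comp_mpoly_meval; apply: meval_eq.
by elim/ord2_ind; rewrite (tnth_nth 0) /= -(coef_dehom (homogenize_homog _ _)) homogenizeK.
Qed.

End TopDegree.

(** * Reparametrizations of degree one *)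

Section DegreeOne.
Variable R : fieldType.
Implicit Types (p q : 'I_4 -> {mpoly R[2]}).

Lemma dehom_linform (a b : R) : dehom (linform a b) = a *: 'X + b%:P.
Proof.
by rewrite /dehom rmorphD /= !subst_pairZ !subst_pairX /= alg_polyC.
Qed.

(** Were the determinant zero, the zero of one of the two polynomials would be a
zero of the other one. *)
Lemma coprime_linear_det (a b c d : R) : (a != 0) || (c != 0) ->
  coprimep (a *: 'X + b%:P) (c *: 'X + d%:P) -> a * d - b * c != 0.
Proof.
move=> ac /Bezout_eq1_coprimepP[[u v] /= uv]; apply/eqP=> e0.
have ev x : (a *: 'X + b%:P).[x] = a * x + b by rewrite !hornerE.
have ev' x : (c *: 'X + d%:P).[x] = c * x + d by rewrite !hornerE.
have no_root x : a * x + b = 0 -> c * x + d = 0 -> False.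
  move=> ra rc; have := congr1 (fun P : {poly R} => P.[x]) uv.
  rewrite hornerD !hornerM ev ev' ra rc !mulr0 addr0 hornerC.
  by move/esym/eqP; rewrite oner_eq0.
have [a0|a0] := eqVneq a 0.
  move: ac e0; rewrite a0 eqxx mul0r sub0r /= => c0 /eqP.
  rewrite oppr_eq0 mulf_eq0 (negbTE c0) orbF => /eqP b0.
  by apply: (no_root (- d / c)); [rewrite a0 b0 mul0r addr0 | field].
apply: (no_root (- b / a)); first by field.
have -> : c * (- b / a) + d = (a * d - b * c) / a by field.
by rewrite e0 mul0r.
Qed.

Lemma dehom_reach n p : (forall i, p i \is n.-homog) ->
  is_gcd [seq p i | i : 'I_4] 1 -> exists i, (dehom (p i))`_n != 0.
Proof.
move=> pn p1; have [|i pi] := @coprime_nonvanishing R n 4 p pn p1 1 0.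
  by rewrite oner_eq0.
by exists i; rewrite (coef_dehom (pn i)).
Qed.

(** Bezout identities for both families make the factor of proportionality a
nonzero constant.  Comparing top degrees, n on the left and e n on the right
with e the larger degree of B0 and B1, then gives e = 1. *)
Lemma subst_pair_proportional n p q B0 B1 : (0 < n)%N ->
    (forall i, p i \is n.-homog) -> (forall i, q i \is n.-homog) ->
    is_gcd [seq p i | i : 'I_4] 1 -> is_gcd [seq q i | i : 'I_4] 1 ->
    coprimep B0 B1 ->
    (forall i j, dehom (p i) * subst_pair B0 B1 (q j) =
                 dehom (p j) * subst_pair B0 B1 (q i)) ->
  exists a b c d lam, [/\ a * d - b * c != 0, lam != 0 &
    forall i, p i = lam *: (q i \mPo linsubst a b c d)].
Proof.
move=> n0 pn qn p1 q1 cop E.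
have [C C1] := subst_pair_coprime qn q1 cop.
have [C' C1'] := dehom_coprime pn p1.
(* the Bezout coefficients of the q_j(B) produce the factor of proportionality *)
pose lam := \sum_j C j * dehom (p j).
have pE i : dehom (p i) = lam * subst_pair B0 B1 (q i).
  rewrite -[LHS]mulr1 -C1 mulr_sumr mulr_suml; apply: eq_bigr => j _.
  by rewrite mulrCA E mulrA.
have : lam %| 1.
  rewrite -C1'; apply/dvdpP; exists (\sum_i C' i * subst_pair B0 B1 (q i)).
  rewrite mulr_suml; apply: eq_bigr => i _; rewrite pE; ring.
rewrite dvdp1 => /size_poly1P[l l0 lE].
pose e := (maxn (size B0) (size B1)).-1.
have [s0 s1] : (size B0 <= e.+1)%N /\ (size B1 <= e.+1)%N.
  by rewrite /e; move: (size B0) (size B1) => x y; split; lia.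
have beta : (B0`_e != 0) || (B1`_e != 0).
  have : (B0 != 0) || (B1 != 0).
    case: eqVneq cop => // ->; case: eqVneq => // ->; 
    by rewrite /coprimep gcd0p size_poly0.
  rewrite /e; case: (leqP (size B0) (size B1)) => sB B01.
    have B1_neq0 : B1 != 0.
      apply: contraTneq B01 => B10; move: sB.
      by rewrite B10 size_poly0 leqn0 size_poly_eq0 => ->; rewrite eqxx.
    by rewrite -/(lead_coef B1) lead_coef_eq0 B1_neq0 orbT.
  have B0_neq0 : B0 != 0 by rewrite -size_poly_gt0 (leq_ltn_trans _ sB).
  by rewrite -/(lead_coef B0) lead_coef_eq0 B0_neq0.
have [i qi] := coprime_nonvanishing qn q1 beta.
have [_ top] := subst_pair_top (qn i) s0 s1.
have [j pj] := dehom_reach pn p1.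
have le1 : (e * n <= n)%N.
  rewrite leqNgt; apply: contra qi => lt.
  rewrite -top; have := congr1 (fun P : {poly R} => P`_(e * n)) (pE i).
  rewrite lE mul_polyC coefZ.
  rewrite nth_default ?(leq_trans (size_dehom (pn i))) // => /esym/eqP.
  by rewrite mulf_eq0 (negbTE l0).
have le2 : (n <= e * n)%N.
  rewrite leqNgt; apply: contra pj => lt.
  rewrite pE lE mul_polyC coefZ nth_default ?mulr0 //.
  by rewrite (leq_trans (subst_pair_top (qn j) s0 s1).1).
have e1 : e = 1%N.
  by apply/eqP; rewrite -(eqn_pmul2r n0) mul1n eqn_leq le1.
rewrite e1 in s0 s1 beta.
have lin (P : {poly R}) : (size P <= 2)%N -> P = P`_1 *: 'X + (P`_0)%:P.
  move=> sP; apply/polyP=> k; rewrite coefD coefZ coefX coefC.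
  case: k => [|[|k]] /=; rewrite ?mulr0 ?mulr1 ?add0r ?addr0 //.
  by rewrite nth_default // (leq_trans sP).
exists B0`_1, B0`_0, B1`_1, B1`_0, l.
split=> // [|k].
  by apply: coprime_linear_det => //; rewrite -!lin.
apply: (@dehom_inj _ n) => //.
  apply: rpredZ; rewrite -[n]mul1n; apply: comp_mpoly_homog => //; elim/ord2_ind;
  by rewrite (tnth_nth 0) /= /linform rpredD // rpredZ // dhomogX /= mdeg1.
rewrite pE lE mul_polyC /dehom subst_pairZ subst_pair_comp !(tnth_nth 0) /=.
by rewrite -!/(dehom _) !dehom_linform -!lin.
Qed.

(** A common factor g of A0 and A1 scales all q_i(A0, A1) by g^n. *)
Lemma reparametrization_mobius n p q A0 A1 : (0 < n)%N ->
    (forall i, p i \is n.-homog) -> (forall i, q i \is n.-homog) ->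
    is_gcd [seq p i | i : 'I_4] 1 -> is_gcd [seq q i | i : 'I_4] 1 ->
    (A0 != 0) || (A1 != 0) ->
    (forall i j, dehom (p i) * subst_pair A0 A1 (q j) =
                 dehom (p j) * subst_pair A0 A1 (q i)) ->
  exists a b c d lam, [/\ a * d - b * c != 0, lam != 0 &
    forall i, p i = lam *: (q i \mPo linsubst a b c d)].
Proof.
move=> n0 pn qn p1 q1 A_neq0 E.
pose g := gcdp A0 A1.
have g0 : g != 0 by rewrite gcdp_eq0 negb_and.
have A0E : A0 = g * (A0 %/ g) by rewrite mulrC divpK // dvdp_gcdl.
have A1E : A1 = g * (A1 %/ g) by rewrite mulrC divpK // dvdp_gcdr.
apply: (@subst_pair_proportional n p q (A0 %/ g) (A1 %/ g)) => //.
  exact: coprimep_div_gcd.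
move=> i j; apply: (@mulfI _ (g ^+ n)); first exact: expf_neq0.
rewrite mulrCA [RHS]mulrCA -!(subst_pair_homog _ _ _ (qn _)) -A0E -A1E.
exact: E.
Qed.

End DegreeOne.

(** * From equivalent curves to related parametrizations *)

Section Curves.
Local Notation pcomp := Defs.pcomp.
Variable R : realType.
Implicit Types (p q : 'cV[{mpoly R[2]}]_4) (C : 'cV[R]_4 -> Prop) (M : 'M[R]_4).

Lemma horner_eq0 (P : {poly R}) : (forall x, P.[x] = 0) -> P = 0.
Proof.
move=> P0; apply/eqP; apply/negPn/negP => nP.
have := @max_poly_roots _ P [seq i%:R | i <- iota 0 (size P)] nP.
rewrite size_map size_iota ltnn => H; apply: notF; apply: H.
  by apply/allP=> x _; rewrite /root P0.
rewrite map_inj_uniq ?iota_uniq // => i j /eqP; rewrite eqr_nat; exact: eqP.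
Qed.

Definition affine_point (x : R) : 'cV[R]_2 := \col_i ord2_fun x 1 i.

Lemma affine_point_neq0 x : affine_point x != 0.
Proof. by apply/eqP=> /colP/(_ 1)/eqP; rewrite !mxE oner_eq0. Qed.

Lemma horner_dehom f x : (dehom f).[x] = cveval f (affine_point x).
Proof.
rewrite /dehom horner_subst_pair; apply: meval_eq => i.
by rewrite mxE hornerX hornerC.
Qed.

Lemma cveval_homog m d (f : {mpoly R[m]}) k x : f \is d.-homog ->
  cveval f (k *: x) = k ^+ d * cveval f x.
Proof. by move=> fd; apply: mmap_homog fd _ => i; rewrite mxE. Qed.

Lemma peval_homog n p k t : homogeneous_param n p ->
  peval p (k *: t) = k ^+ n *: peval p t.
Proof. by move=> pn; apply/colP=> i; rewrite !mxE (cveval_homog _ _ (pn i)). Qed.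

Lemma cveval_pcomp f p t : cveval (pcomp f p) t = cveval f (peval p t).
Proof.
rewrite /cveval /pcomp comp_mpoly_meval; apply: meval_eq => i.
by rewrite tnth_mktuple mxE.
Qed.

Lemma pcomp_homog n d f p : homogeneous_param n p -> f \is d.-homog ->
  pcomp f p \is (n * d).-homog.
Proof.
by move=> pn fd; apply: comp_mpoly_homog => // i; rewrite tnth_mktuple; apply: pn.
Qed.

Local Notation "M %:MM" := (map_mx (@mpolyC 2 R) M) (at level 2).

Lemma peval_mulmx M p t : peval (M%:MM *m p) t = M *m peval p t.
Proof.
apply/colP=> i; rewrite !mxE /cveval rmorph_sum; apply: eq_bigr => j _ /=.
by rewrite mevalM !mxE mevalC.
Qed.

Lemma mulmx_homog n M p : homogeneous_param n p -> homogeneous_param n (M%:MM *m p).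
Proof.
move=> pn i; rewrite mxE; apply: rpred_sum => j _.
by rewrite mxE mul_mpolyC rpredZ.
Qed.

Lemma mulmx_gcd M p : M \in unitmx -> is_gcd [seq p i 0 | i : 'I_4] 1 ->
  is_gcd [seq (M%:MM *m p) i 0 | i : 'I_4] 1.
Proof.
move=> uM [_ p1]; split=> [f _|D HD]; first by exists f; rewrite mulr1.
apply: p1 => f /imageP[i _ ->].
have -> : p = (invmx M)%:MM *m (M%:MM *m p).
  by rewrite mulmxA -map_mxM mulVmx // map_mx1 mul1mx.
rewrite mxE; apply: (big_ind (fun f => mdvd D f)).
- by exists 0; rewrite mul0r.
- by move=> x y [k ->] [l ->]; exists (k + l); rewrite mulrDl.
move=> j _; have [k ->] : mdvd D ((M%:MM *m p) j 0).
  by apply: HD; apply/imageP; exists j.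
by exists ((invmx M)%:MM i j * k); rewrite mulrA.
Qed.

Lemma peval_on_curve p C t : birational_onto p C ->
  t != 0 -> peval p t != 0 -> C (peval p t).
Proof.
move=> [Cp _] t0 p0; apply/Cp; split=> // d f _ f0; apply: f0.
by split=> //; exists t => //; exists 1; rewrite ?oner_neq0 ?scale1r.
Qed.

(** Being homogeneous, f vanishes at every multiple of a parametrized point, hence
on the Zariski closure of the image. *)
Lemma vanish_on_curve p C d (f : {mpoly R[4]}) : birational_onto p C ->
    f \is d.-homog -> (forall t, cveval f (peval p t) = 0) ->
  forall x, C x -> cveval f x = 0.
Proof.
move=> [Cp _] fd f0 x /Cp[_]; apply=> [|y [_ [t _ [k k0 tE]]]]; first exact: fd.
have := f0 t; rewrite tE (cveval_homog _ _ fd) => /eqP.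
by rewrite mulf_eq0 expf_eq0 (negbTE k0) andbF => /eqP.
Qed.

(** The pair A is the rational inverse h of q composed with M p.  It is not zero:
otherwise h would vanish on M C1 = C2, hence along q, and could not invert q. *)
Lemma reparametrization_of_equivalence n p q C1 C2 M : (0 < n)%N ->
    homogeneous_param n p -> homogeneous_param n q ->
    birational_onto p C1 -> birational_onto q C2 ->
    is_gcd [seq p i 0 | i : 'I_4] 1 -> is_gcd [seq q i 0 | i : 'I_4] 1 ->
    M \in unitmx -> (forall y, C2 y <-> exists2 x, C1 x & y = M *m x) ->
  exists a b c d lam, [/\ a * d - b * c != 0, lam != 0 &
    M%:MM *m p = (lam%:M)%:MM *m map_mx (comp_mpoly (linsubst a b c d)) q].
Proof.
move=> n0 pn qn pC qC p1 q1 uM CM.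
have [_ [d [h [hd [i0 hi0] _ hinv]]]] := qC.
pose Mp := M%:MM *m p.
have Mpn : homogeneous_param n Mp := mulmx_homog M pn.
pose A j := dehom (pcomp (h j 0) Mp).
have AE x : peval h (M *m peval p (affine_point x)) = \col_j (A j).[x].
  by apply/colP=> j; rewrite !mxE horner_dehom cveval_pcomp peval_mulmx.
have A_neq0 : (A 0 != 0) || (A 1 != 0).
  rewrite -negb_and; apply/negP => /andP[/eqP A0 /eqP A1].
  have h_p j t : cveval (h j 0) (M *m peval p t) = 0.
    rewrite -peval_mulmx -cveval_pcomp (_ : pcomp _ _ = 0) ?/cveval ?meval0 //.
    apply: (dehom_inj (pcomp_homog Mpn (hd j)) (dhomog0 _ _ _)).
    by rewrite [RHS]dehom0; elim/ord2_ind: j; [exact: A0 | exact: A1].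
  pose L := [tuple \sum_k M i k *: 'X_k | i < 4] : 4.-tuple {mpoly R[4]}.
  have hM x : cveval (h i0 0 \mPo L) x = cveval (h i0 0) (M *m x).
    rewrite /cveval comp_mpoly_meval; apply: meval_eq => i.
    rewrite tnth_mktuple mxE rmorph_sum; apply: eq_bigr => k _ /=.
    by rewrite mevalZ mevalXU.
  have hMd : h i0 0 \mPo L \is d.-homog.
    rewrite -[d]mul1n; apply: comp_mpoly_homog => // i; rewrite tnth_mktuple.
    by apply: rpred_sum => k _; rewrite rpredZ // dhomogX /= mdeg1.
  have h_C2 y : C2 y -> cveval (h i0 0) y = 0.
    move=> /CM[x C1x ->]; rewrite -hM; apply: (vanish_on_curve pC hMd) C1x => t.
    by rewrite hM.
  have [c c1] := dehom_coprime qn q1.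
  have hq0 : dehom (pcomp (h i0 0) q) = 0.
    rewrite -[LHS]mul1r -c1 mulr_suml big1 // => j _; rewrite -mulrA.
    rewrite (_ : dehom _ * _ = 0) ?mulr0 //; apply: horner_eq0 => x.
    rewrite hornerM !horner_dehom cveval_pcomp.
    have [q0|q0] := eqVneq (peval q (affine_point x)) 0.
      by have /colP/(_ j) := q0; rewrite !mxE => ->; rewrite mul0r.
    by rewrite h_C2 ?mulr0 //; apply: peval_on_curve qC (affine_point_neq0 x) q0.
  case/eqP: hi0; apply: (dehom_inj (pcomp_homog qn (hd i0)) (dhomog0 _ _ _)).
  by rewrite hq0 [RHS]dehom0.
have prop i j : dehom (Mp i 0) * subst_pair (A 0) (A 1) (q j 0) =
                dehom (Mp j 0) * subst_pair (A 0) (A 1) (q i 0).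
  apply/eqP; rewrite -subr_eq0; apply/eqP; apply: horner_eq0 => x.
  rewrite hornerD hornerN !hornerM (horner_dehom (Mp i 0)) (horner_dehom (Mp j 0)).
  rewrite (horner_subst_pair _ _ _ (q j 0)) (horner_subst_pair _ _ _ (q i 0)).
  set H : 'cV[R]_2 := \col_j (A j).[x].
  have qH k : (q k 0).@[ord2_fun (A 0).[x] (A 1).[x]] = peval q H k 0.
    by rewrite mxE; apply: meval_eq; elim/ord2_ind; rewrite mxE.
  have MpE k : cveval (Mp k 0) (affine_point x) = (M *m peval p (affine_point x)) k 0.
    by rewrite -peval_mulmx [RHS]mxE.
  rewrite !qH !MpE; have [p0|p0] := eqVneq (peval p (affine_point x)) 0.
    by rewrite p0 mulmx0 !mxE !mul0r subrr.
  (* at a base point of h, q(H) = q(0) = 0 and both products vanish *)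
  have [H0|H0] := eqVneq H 0.
    rewrite H0 -(scale0r (0 : 'cV_2)) (peval_homog _ _ qn) expr0n (gtn_eqF n0).
    by rewrite scale0r !mxE !mulr0 subrr.
  have C2x : C2 (M *m peval p (affine_point x)).
    apply/CM; exists (peval p (affine_point x)) => //.
    exact: peval_on_curve pC (affine_point_neq0 x) p0.
  have := hinv _ C2x; rewrite AE -/H => /(_ H0)[k _ ->].
  by move: (M *m _) => y; rewrite (mxE _ _ i) (mxE _ _ j); ring.
have := reparametrization_mobius n0 Mpn qn (mulmx_gcd uM p1) q1 A_neq0 prop.
move=> [a [b [c [e [lam [e0 l0 E]]]]]]; exists a, b, c, e, lam; split=> //.
by apply/colP=> i; rewrite -/Mp E map_scalar_mx mul_scalar_mx !mxE mul_mpolyC.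
Qed.

End Curves.

(** * Matrices given by columns *)

Definition of_cols (A : pzRingType) m n (s : seq 'cV[A]_m) : 'M[A]_(m, n) :=
  \matrix_(i, j) nth 0 s j i 0.

Definition colvec (A : pzRingType) n (s : seq A) : 'cV[A]_n := \col_i s`_i.

Lemma mul_of_cols4 (A : pzRingType) m (c1 c2 c3 c4 : 'cV[A]_m) j1 j2 j3 j4 i :
  (of_cols 4 [:: c1; c2; c3; c4] *m colvec 4 [:: j1; j2; j3; j4]) i 0
  = c1 i 0 * j1 + c2 i 0 * j2 + c3 i 0 * j3 + c4 i 0 * j4.
Proof. by rewrite mxE !big_ord_recr big_ord0 /= add0r !mxE. Qed.

(** Cramer's rule: expanding along the replaced column leaves the cofactors of the
original matrix. *)
Lemma cramer_of_cols (K : fieldType) n (s : seq 'cV[K]_n) (z x : 'cV[K]_n) (k : 'I_n) :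
  \det (of_cols n s) != 0 -> of_cols n s *m z = x ->
  \det (of_cols n (set_nth 0 s k x)) / \det (of_cols n s) = z k 0.
Proof.
move=> d0 zx; set B := of_cols n (set_nth 0 s k x).
apply: (canLR (mulfK d0)); rewrite (expand_det_col B k).
have -> : z k 0 * \det (of_cols n s) = (\adj (of_cols n s) *m x) k 0.
  by rewrite -zx mulmxA mul_adj_mx mul_scalar_mx mxE mulrC.
rewrite mxE; apply: eq_bigr => i _.
rewrite !mxE nth_set_nth /= eqxx mulrC; congr (_ * _).
rewrite /cofactor; congr (_ * \det _).
apply/matrixP=> a b; rewrite !mxE nth_set_nth /=.
rewrite [(_ == _) in LHS](inj_eq val_inj (lift k b) k) eq_sym.
by rewrite (negbTE (neq_lift _ _)).
Qed.


(** * The curvature formulas under a change of parameter *)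

Section CurvatureFormula.
Variable K : fieldType.
Implicit Types N x y i : K.

(** The curvatures as functions of the degree N, the parameters (x, y) and the
coordinates i1, ..., i4 of the fourth derivative. *)
Definition curvature1 N x y i1 i2 i3 i4 : K :=
  (8 * (N - 3) ^+ 2 * (y * i1 - x * i2) + 4 * (N - 1) * (N - 3) * y * i3 * i4
     + (N - 1) * (N - 2) * y * i4 ^+ 3) ^+ 2
  / (y ^+ 2 * (8 * (N - 3) * i3 + 3 * (N - 2) * i4 ^+ 2) ^+ 3).

Definition curvature2 N x y i1 i2 i3 i4 : K :=
  (256 * (N - 3) ^+ 3 * i2 + 64 * (N - 3) ^+ 2 * (y * i1 - x * i2) * i4
     + 16 * (N - 1) * (N - 3) * y * i3 * i4 ^+ 2
     + 3 * (N - 1) * (N - 2) * y * i4 ^+ 4)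
  / (y * (8 * (N - 3) * i3 + 3 * (N - 2) * i4 ^+ 2) ^+ 2).

Variables (N a b c d x y : K).
Let e := a * d - b * c.
Let u := a * x + b * y.
Let v := c * x + d * y.
Hypotheses (e0 : e != 0) (y0 : y != 0) (v0 : v != 0).
Let al := e * y / v.
Let ga := c / v.

Variables i1 i2 i3 i4 : K.
(** The coordinates after the change of parameter.  Put x_k for the k-th derivative
of q in u and z for the derivative in v, taken at (u, v), and w_k for the
k-th derivative in x and z' for the derivative in y of q as a function of (x, y).  If
x_4 = i1 x_1 + i2 z + i3 x_2 + i4 x_3, then eliminating x_2 and x_3 gives
w_4 = part_w1 w_1 + part_x1 x_1 + al^4 i2 z + newI3 w_2 + newI4 w_3,
and x_1 = (d w_1 - c z') / e, z = (a z' - b w_1) / e give newI1 and newI2. *)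
Definition part_x1 := al ^+ 4 * i1 - al ^+ 3 * ga * (N - 1) * i3
  + al ^+ 2 * ga ^+ 2 * (N - 1) * (N - 2) * i4
  + al * ga ^+ 3 * (N - 1) * (N - 2) * (N - 3).
Definition part_w1 := - al ^+ 2 * ga * (N - 1) * i3
  + 2 * al * ga ^+ 2 * (N - 1) * (N - 2) * i4
  + 3 * ga ^+ 3 * (N - 1) * (N - 2) * (N - 3).
Definition newI1 := part_w1 + (d * part_x1 - b * (al ^+ 4 * i2)) / e.
Definition newI2 := (a * (al ^+ 4 * i2) - c * part_x1) / e.
Definition newI3 := al ^+ 2 * i3 - 3 * al * ga * (N - 2) * i4
  - 6 * ga ^+ 2 * (N - 2) * (N - 3).
Definition newI4 := al * i4 + 4 * ga * (N - 3).

(** The terms in ga cancel: this is why the combination is a denominator of both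
curvatures. *)
Lemma discriminant_moved : 8 * (N - 3) * newI3 + 3 * (N - 2) * newI4 ^+ 2
  = al ^+ 2 * (8 * (N - 3) * i3 + 3 * (N - 2) * i4 ^+ 2).
Proof. rewrite /newI3 /newI4; ring. Qed.

Lemma scale_neq0 : al != 0.
Proof. by rewrite /al !mulf_neq0 ?invr_eq0. Qed.

Lemma curvature1_moved :
  curvature1 N x y newI1 newI2 newI3 newI4 = curvature1 N u v i1 i2 i3 i4.
Proof.
rewrite /curvature1 discriminant_moved.
set D := 8 * (N - 3) * i3 + 3 * (N - 2) * i4 ^+ 2.
set n := (X in X ^+ 2 / _ = _); set n' := (X in _ = X ^+ 2 / _).
(* n and n' are the numerators; the factor matches the one which
   [discriminant_moved] gives for the denominators *)
have -> : n = y / v * al ^+ 3 * n'.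
  rewrite /n /n' /newI1 /newI2 /newI3 /newI4 /part_w1 /part_x1 /al /ga /u.
  by move: e0 v0; rewrite /e /v => e0' v0'; field; rewrite ?e0' ?v0'.
have a0 := scale_neq0; clearbody al n n'.
(* when D = 0 both sides are quotients by zero *)
have [->|D0] := eqVneq D 0; last by field; rewrite ?D0 ?a0 ?v0 ?y0.
by rewrite !(mulr0, expr0n) /= ?mulr0 invr0 !mulr0.
Qed.

Lemma curvature2_moved :
  curvature2 N x y newI1 newI2 newI3 newI4 = curvature2 N u v i1 i2 i3 i4.
Proof.
rewrite /curvature2 discriminant_moved.
set D := 8 * (N - 3) * i3 + 3 * (N - 2) * i4 ^+ 2.
set n := (X in X / _ = _); set n' := (X in _ = X / _).
have -> : n = y / v * al ^+ 4 * n'.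
  rewrite /n /n' /newI1 /newI2 /newI3 /newI4 /part_w1 /part_x1 /al /ga /u.
  by move: e0 v0; rewrite /e /v => e0' v0'; field; rewrite ?e0' ?v0'.
have a0 := scale_neq0; clearbody al n n'.
(* when D = 0 both sides are quotients by zero *)
have [->|D0] := eqVneq D 0; last by field; rewrite ?D0 ?a0 ?v0 ?y0.
by rewrite !(mulr0, expr0n) /= ?mulr0 invr0 !mulr0.
Qed.

End CurvatureFormula.

Section JetChange.
Variables (K : fieldType) (N a b c d t s : K).
Local Notation e := (a * d - b * c).
Local Notation v := (c * t + d * s).
Local Notation al := (e * s / v).
Local Notation ga := (c / v).
Hypotheses (e0 : e != 0) (s0 : s != 0) (v0 : v != 0).

(** The new frame in terms of the old one, from [FS] below: F k l stands for the
k-th derivative in t0 of T applied to the l-th derivative of q in its first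
parameter, so that the F 0 l and y form the old frame, the F k 0 and z the new one. *)
Definition jet_change : 'M[K]_4 := of_cols 4
  [:: colvec 4 [:: a; c; 0; 0]; colvec 4 [:: b; d; 0; 0];
      colvec 4 [:: ga * (N - 1) * (al + a); ga * (N - 1) * c; al ^+ 2; 0];
      colvec 4 [:: ga ^+ 2 * (N - 1) * (N - 2) * (2 * al + a);
                   ga ^+ 2 * (N - 1) * (N - 2) * c;
                   3 * ga * al ^+ 2 * (N - 2); al ^+ 3]].

Definition jet_change_back : 'M[K]_4 := of_cols 4
  [:: colvec 4 [:: d / e; - c / e; 0; 0]; colvec 4 [:: - b / e; a / e; 0; 0];
      colvec 4 [:: - ga * (N - 1) * (1 + al * (d / e)) / al ^+ 2;
                   ga * (N - 1) * (c / e) / al; 1 / al ^+ 2; 0];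
      colvec 4 [:: ga ^+ 2 * (N - 1) * (N - 2) * (2 + al * (d / e)) / al ^+ 3;
                   - (ga ^+ 2 * (N - 1) * (N - 2) * (c / e)) / al ^+ 2;
                   - (3 * ga * (N - 2)) / al ^+ 3; 1 / al ^+ 3]].

Lemma jet_changeK : jet_change *m jet_change_back = 1%:M.
Proof.
have al0 : al != 0 by rewrite !mulf_neq0 ?invr_eq0.
apply/matrixP => i j; rewrite !mxE !big_ord_recr big_ord0 /= !mxE.
move: al0; set x := al; set g := ga => al0.
by case: i => [[|[|[|[|//]]]]] ?; case: j => [[|[|[|[|//]]]]] ?; rewrite !mxE /=;
  field; rewrite ?al0 ?e0.
Qed.

Variables (m : nat) (F : nat -> nat -> 'cV[K]_m) (y z : 'cV[K]_m).
Hypothesis F10 : F 1 0 = a *: F 0 1 + c *: y.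
Hypothesis zE : z = b *: F 0 1 + d *: y.
Hypothesis FS : forall k l, (0 < k + l <= 3)%N ->
  F k.+1 l = al *: F k l.+1 + (ga * (N - (k + l)%:R)) *: F k l.

Lemma jet_frame : of_cols 4 [:: F 1 0; z; F 2 0; F 3 0] =
  of_cols 4 [:: F 0 1; y; F 0 2; F 0 3] *m jet_change.
Proof.
apply/matrixP => i j; rewrite !mxE !big_ord_recr big_ord0 /= !mxE /=.
rewrite !(F10, zE, FS) //.
case: j => [[|[|[|[|//]]]]] ?; rewrite !mxE /=; ring.
Qed.

Lemma jet_coords i1 i2 i3 i4 :
    of_cols 4 [:: F 0 1; y; F 0 2; F 0 3] *m colvec 4 [:: i1; i2; i3; i4] = F 0 4 ->
  of_cols 4 [:: F 1 0; z; F 2 0; F 3 0] *m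
    colvec 4 [:: newI1 N a b c d t s i1 i2 i3 i4;
                 newI2 N a b c d t s i1 i2 i3 i4;
                 newI3 N a b c d t s i3 i4; newI4 N a b c d t s i4] = F 4 0.
Proof.
move=> /colP E; apply/colP=> i; move: {E}(E i).
rewrite !mul_of_cols4 !(F10, zE, FS) // => E.
have {}E : F 0 4 i 0 = F 0 1 i 0 * i1 + y i 0 * i2 + F 0 2 i 0 * i3 + F 0 3 i 0 * i4.
  by [].
rewrite !mxE E /newI1 /newI2 /newI3 /newI4 /part_w1 /part_x1.
move: (al) (ga) => x g.
field.
by rewrite e0.
Qed.
End JetChange.

(** * Morphisms of fraction fields *)

Section FractionMorphism.
Variables (A B : idomainType) (g : {rmorphism A -> B}).
Hypothesis g_inj : injective g.
Local Notation "x %:F" := (@FracField.tofrac _ x).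

Definition frac_map (x : {fraction A}) : {fraction B} :=
  (g \n_(repr x))%:F / (g \d_(repr x))%:F.

Lemma frac_repr (x : {fraction A}) : x = (\n_(repr x))%:F / (\d_(repr x))%:F.
Proof.
move: (reprK x); set s := repr x => <-.
have d0 : \d_s != 0 by exact: denom_ratioP.
apply: (canRL (mulfK _)); first by rewrite tofrac_eq0.
rewrite !piE; apply/eqmodP; rewrite /= FracField.equivfE /FracField.mulf.
by rewrite !numden_Ratio ?mulr1 ?oner_neq0 // mulrC.
Qed.

(** The representative of n / d chosen by [repr] is another fraction with the same
value; g respects the cross-multiplied equality because it is injective. *)
Lemma frac_map_div n d : d != 0 -> frac_map (n%:F / d%:F) = (g n)%:F / (g d)%:F.
Proof.
move=> d0; rewrite /frac_map; set x := n%:F / d%:F.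
have d'0 : \d_(repr x) != 0 by exact: denom_ratioP.
have gn0 z : z != 0 -> (g z)%:F != 0.
  by move=> z0; rewrite tofrac_eq0 -(rmorph0 g) (inj_eq g_inj).
apply/eqP; rewrite eqr_div ?gn0 // -!tofracM tofrac_eq -!rmorphM (inj_eq g_inj).
by rewrite -tofrac_eq !tofracM -eqr_div ?tofrac_eq0 // -frac_repr.
Qed.

Lemma frac_map_tofrac f : frac_map f%:F = (g f)%:F.
Proof.
by rewrite -[f%:F]divr1 -(tofrac1 A) frac_map_div ?oner_neq0 //
  rmorph1 tofrac1 divr1.
Qed.

Lemma frac_map_is_zmod_morphism : zmod_morphism frac_map.
Proof.
move=> x y; rewrite (frac_repr x) (frac_repr y).
set n := \n_(repr x); set d := \d_(repr x).
set n' := \n_(repr y); set d' := \d_(repr y).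
have d0 : d != 0 by exact: denom_ratioP.
have d'0 : d' != 0 by exact: denom_ratioP.
have gn0 z : z != 0 -> g z != 0.
  by move=> z0; rewrite -(rmorph0 g) (inj_eq g_inj).
rewrite -mulNr addf_div ?tofrac_eq0 // -tofracN -!tofracM -tofracD.
rewrite !frac_map_div ?mulf_neq0 // -[in RHS]mulNr addf_div ?tofrac_eq0 ?gn0 //.
by rewrite rmorphD !rmorphM rmorphN tofracD !tofracM tofracN.
Qed.

Lemma frac_map_is_monoid_morphism : monoid_morphism frac_map.
Proof.
split; first by rewrite -(tofrac1 A) frac_map_tofrac rmorph1 !tofrac1.
move=> x y; rewrite (frac_repr x) (frac_repr y) mulf_div -!tofracM.
rewrite !frac_map_div ?mulf_neq0 ?denom_ratioP //.
by rewrite !rmorphM mulf_div.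
Qed.

(** Used for g = substitution of an invertible linear map, to speak of
kappa_i(q)(phi). *)
Lemma frac_extension :
  exists h : {rmorphism {fraction A} -> {fraction B}}, forall f, h f%:F = (g f)%:F.
Proof.
pose h : {rmorphism {fraction A} -> {fraction B}} := HB.pack frac_map
  (GRing.isZmodMorphism.Build _ _ frac_map frac_map_is_zmod_morphism)
  (GRing.isMonoidMorphism.Build _ _ frac_map frac_map_is_monoid_morphism).
by exists h => f; exact: frac_map_tofrac.
Qed.

End FractionMorphism.

(** * Curvatures as functions of frame coordinates *)

Section Frame.
Variable R : realType.
Local Notation K := {fraction {mpoly R[2]}}.
Local Notation "x %:F" := (@FracField.tofrac _ x).
Implicit Types u : 'cV[{mpoly R[2]}]_4.

Definition to_frac_col u : 'cV[K]_4 := map_mx (fun f => f%:F) u.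

Definition frame_cols u : seq 'cV[K]_4 :=
  [:: to_frac_col (pderiv u 1 0); to_frac_col (pderiv u 0 1);
      to_frac_col (pderiv u 2 0); to_frac_col (pderiv u 3 0)].

Definition frame u : 'M[K]_4 := of_cols 4 (frame_cols u).
Definition fourth_derivative u := to_frac_col (pderiv u 4 0).

Lemma tofrac_det4 w1 w2 w3 w4 : (det4 w1 w2 w3 w4)%:F =
  \det (of_cols 4 [:: to_frac_col w1; to_frac_col w2; to_frac_col w3; to_frac_col w4]).
Proof.
rewrite /det4 -(det_map_mx (@FracField.tofrac {mpoly R[2]})).
congr (\det _); apply/matrixP=> i j; rewrite !mxE.
by case: j => [[|[|[|[|]]]]] //= _; rewrite !mxE.
Qed.

Lemma det_frame u : \det (frame u) = (Delta u)%:F.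
Proof. by rewrite tofrac_det4. Qed.

(** The A_i are the determinants of Cramer's rule for the system with matrix
[frame u]. *)
Lemma frame_coords u i1 i2 i3 i4 : Delta u != 0 ->
    frame u *m colvec 4 [:: i1; i2; i3; i4] = fourth_derivative u ->
  [/\ I1 u = i1, I2 u = i2, I3 u = i3 & I4 u = i4].
Proof.
move=> D0 coords; have d0 : \det (frame u) != 0 by rewrite det_frame tofrac_eq0.
have quotient (k : 'I_4) w1 w2 w3 w4 :
    map to_frac_col [:: w1; w2; w3; w4] =
      set_nth 0 (frame_cols u) k (fourth_derivative u) ->
    (det4 w1 w2 w3 w4)%:F / (Delta u)%:F = colvec 4 [:: i1; i2; i3; i4] k 0.
  by move=> E; rewrite -det_frame tofrac_det4 -(cramer_of_cols k d0 coords) -E.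
pose x1 := pderiv u 1 0; pose y1 := pderiv u 0 1; pose x2 := pderiv u 2 0.
pose x3 := pderiv u 3 0; pose x4 := pderiv u 4 0.
have h1 := quotient 0 x4 y1 x2 x3 erefl; have h2 := quotient 1 x1 x4 x2 x3 erefl.
have h3 := quotient 2%:R x1 y1 x4 x3 erefl; have h4 := quotient 3%:R x1 y1 x2 x4 erefl.
rewrite mxE in h1; rewrite mxE in h2; rewrite mxE in h3; rewrite mxE in h4.
by split; [exact: h1 | exact: h2 | exact: h3 | exact: h4].
Qed.

Lemma frame_mul_coords u : Delta u != 0 ->
  frame u *m colvec 4 [:: I1 u; I2 u; I3 u; I4 u] = fourth_derivative u.
Proof.
move=> d0; have fu : frame u \in unitmx.
  by rewrite unitmxE det_frame unitfE tofrac_eq0.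
pose z := invmx (frame u) *m fourth_derivative u.
have E : frame u *m colvec 4 [:: z 0 0; z 1 0; z 2%:R 0; z 3%:R 0] =
    fourth_derivative u.
  rewrite -[RHS](mulKVmx fu) -/z; congr (_ *m _); apply/colP=> i.
  rewrite [LHS]mxE; clearbody z.
  by case: i => [[|[|[|[|]]]]] //= ?; congr (z _ _); apply: val_inj.
by have [-> -> -> ->] := frame_coords d0 E.
Qed.

Lemma coords_eq0 u : Delta u = 0 -> [/\ I1 u = 0, I2 u = 0, I3 u = 0 & I4 u = 0].
Proof. 
rewrite /I1 /I2 /I3 /I4 => ->.
by move: (A1 u) (A2 u) (A3 u) (A4 u) => a1 a2 a3 a4; rewrite tofrac0 invr0 !mulr0. Qed.

(** Over a degenerate frame the quotients I_i are quotients by zero. *)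
Lemma kappa_eq0 n u : Delta u = 0 -> kappa1 n u = 0 /\ kappa2 n u = 0.
Proof.
move=> /coords_eq0[i1 i2 i3 i4]; rewrite /kappa1 /kappa2 /I0 i1 i2 i3 i4.
by rewrite !(mulr0, expr0n, addr0, subr0, mul0r).
Qed.

Lemma kappaE n u :
  kappa1 n u = curvature1 n%:R (t0 R) (t1 R) (I1 u) (I2 u) (I3 u) (I4 u) /\
  kappa2 n u = curvature2 n%:R (t0 R) (t1 R) (I1 u) (I2 u) (I3 u) (I4 u).
Proof.
rewrite /kappa1 /kappa2 /curvature1 /curvature2 /I0.
move: (I1 u) (I2 u) (I3 u) (I4 u) => i1 i2 i3 i4.
by move: (t0 R) (t1 R).
Qed.

Lemma kappa_of_coords n u i1 i2 i3 i4 : Delta u != 0 ->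
    frame u *m colvec 4 [:: i1; i2; i3; i4] = fourth_derivative u ->
  kappa1 n u = curvature1 n%:R (t0 R) (t1 R) i1 i2 i3 i4 /\
  kappa2 n u = curvature2 n%:R (t0 R) (t1 R) i1 i2 i3 i4.
Proof.
move=> D0 /(frame_coords D0)[]; have [-> ->] := kappaE n u.
by move=> -> -> -> ->.
Qed.

Lemma pderiv_mulmx (M : 'M[R]_4) u k l :
  pderiv (map_mx (@mpolyC 2 R) M *m u) k l = map_mx (@mpolyC 2 R) M *m pderiv u k l.
Proof.
apply/colP=> i; rewrite !mxE.
have iterE j m (f : 'I_4 -> {mpoly R[2]}) :
    iter m (mderiv j) (\sum_a map_mx (@mpolyC 2 R) M i a * f a)
    = \sum_a map_mx (@mpolyC 2 R) M i a * iter m (mderiv j) (f a).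
  elim: m => //= m ->; rewrite linear_sum; apply: eq_bigr => a _.
  by rewrite /= mxE mderiv_mulC.
by rewrite !iterE; apply: eq_bigr => a _; rewrite !mxE.
Qed.

(** The frame and the fourth derivative are both multiplied by M, so the
coordinates stay the same. *)
Lemma kappa_mulmx n (M : 'M[R]_4) u : M \in unitmx ->
  let Mu := map_mx (@mpolyC 2 R) M *m u in
  kappa1 n Mu = kappa1 n u /\ kappa2 n Mu = kappa2 n u.
Proof.
move=> uM Mu; pose MK : 'M[K]_4 := map_mx (fun c => (c%:MP)%:F) M.
have to_frac_mul v : to_frac_col (map_mx (@mpolyC 2 R) M *m v) = MK *m to_frac_col v.
  apply/colP=> i; rewrite !mxE rmorph_sum; apply: eq_bigr => j _.
  by rewrite rmorphM !mxE.
have frameM : frame Mu = MK *m frame u.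
  apply/matrixP=> i j; rewrite !mxE.
  have -> : nth 0 (frame_cols Mu) j = MK *m nth 0 (frame_cols u) j.
    by rewrite /frame_cols !pderiv_mulmx !to_frac_mul; case: j => [[|[|[|[|]]]]].
  by rewrite mxE; apply: eq_bigr => k _; rewrite !mxE.
have d0 : \det MK != 0.
  have -> : \det MK = ((\det M)%:MP)%:F.
    rewrite -(det_map_mx (@mpolyC 2 R)) -(det_map_mx (@FracField.tofrac _)).
    by rewrite -map_mx_comp.
  by rewrite tofrac_eq0 mpolyC_eq0 -unitfE -unitmxE.
have dE : (Delta Mu == 0) = (Delta u == 0).
  by rewrite -!(tofrac_eq0 (Delta _)) -!det_frame frameM det_mulmx mulf_eq0 (negbTE d0).
have [D0|D0] := eqVneq (Delta u) 0.
  have DM0 : Delta Mu = 0 by apply/eqP; rewrite dE D0.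
  have [k1 k2] := kappa_eq0 n D0; have [k1' k2'] := kappa_eq0 n DM0.
  by split; [apply: etrans k1' (esym k1) | apply: etrans k2' (esym k2)].
have DM0 : Delta Mu != 0 by rewrite dE.
have coords : frame Mu *m colvec 4 [:: I1 u; I2 u; I3 u; I4 u] = fourth_derivative Mu.
  rewrite frameM -mulmxA (frame_mul_coords D0) /fourth_derivative.
  by rewrite pderiv_mulmx to_frac_mul.
have := kappa_of_coords n DM0 coords; have [<- <-] := kappaE n u.
exact: id.
Qed.

End Frame.

(** * Invariance of the curvatures *)

Lemma rmorph_curvature1 (K K' : fieldType) (h : {rmorphism K -> K'})
    N x y i1 i2 i3 i4 :
  h (curvature1 N x y i1 i2 i3 i4) =
  curvature1 (h N) (h x) (h y) (h i1) (h i2) (h i3) (h i4).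
Proof.
rewrite /curvature1 fmorph_div.
by rewrite !(rmorphM, rmorphD, rmorphN, rmorphXn, rmorph_nat, rmorph1).
Qed.

Lemma rmorph_curvature2 (K K' : fieldType) (h : {rmorphism K -> K'})
    N x y i1 i2 i3 i4 :
  h (curvature2 N x y i1 i2 i3 i4) =
  curvature2 (h N) (h x) (h y) (h i1) (h i2) (h i3) (h i4).
Proof.
rewrite /curvature2 fmorph_div.
by rewrite !(rmorphM, rmorphD, rmorphN, rmorphXn, rmorph_nat, rmorph1).
Qed.

Lemma jet_step_field (K : fieldType) (w e s c f1 f0 j : K) : w != 0 ->
  e * (s * f1) + c * j * f0 = w * (e * s / w * f1 + c / w * j * f0).
Proof. by move=> w0; field. Qed.

Section Reparametrization.
Variables (R : realType) (n : nat) (q : 'cV[{mpoly R[2]}]_4) (a b c d : R).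
Hypotheses (n_gt3 : (3 < n)%N) (qn : homogeneous_param n q).
Hypothesis e0 : a * d - b * c != 0.
Local Notation A := {mpoly R[2]}.
Local Notation K := {fraction A}.
Local Notation "x %:F" := (@FracField.tofrac _ x).
Local Notation T := (comp_mpoly (linsubst a b c d)).
Variable h : {rmorphism K -> K}.
Hypothesis hT : forall f : A, h f%:F = (T f)%:F.

Local Notation cst x := ((x%:MP : A)%:F).
Local Notation v := (cst c * t0 R + cst d * t1 R).
Local Notation al := ((cst a * cst d - cst b * cst c) * t1 R / v).
Local Notation ga := (cst c / v).

Let F k l : 'cV[K]_4 :=
  to_frac_col (map_mx (fun f => iter k (mderiv 0) (T (iter l (mderiv 0) f))) q).
Let y : 'cV[K]_4 := to_frac_col (map_mx (fun f => T (mderiv 1 f)) q).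
Let Tq : 'cV[A]_4 := map_mx T q.
Let z : 'cV[K]_4 := to_frac_col (pderiv Tq 0 1).

Let FE k l i : F k l i 0 = (iter k (mderiv 0) (T (iter l (mderiv 0) (q i 0))))%:F.
Proof. by rewrite mxE [X in X%:F]mxE. Qed.

Let yE i : y i 0 = (T (mderiv 1 (q i 0)))%:F.
Proof. by rewrite mxE [X in X%:F]mxE. Qed.

Let zE i : z i 0 = (mderiv 1 (T (q i 0)))%:F.
Proof. by rewrite mxE [X in X%:F]mxE /= [X in mderiv 1 X]mxE. Qed.

Let comb2E r s (f g : 'cV[K]_4) i : (r *: f + s *: g) i 0 = r * f i 0 + s * g i 0.
Proof. by rewrite mxE; congr (_ + _); rewrite mxE. Qed.

Lemma tofrac_linform x x' : (linform x x')%:F = cst x * t0 R + cst x' * t1 R.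
Proof. by rewrite /linform tofracD -!mul_mpolyC !tofracM. Qed.

Let t1_neq0 : t1 R != 0.
Proof. by rewrite tofrac_eq0 -msize_poly_eq0 msizeX. Qed.

Let ht1 : h (t1 R) = v.
Proof. by rewrite hT comp_mpolyXU /= tofrac_linform. Qed.

Let ht0 : h (t0 R) = cst a * t0 R + cst b * t1 R.
Proof. by rewrite hT comp_mpolyXU /= tofrac_linform. Qed.

Let v_neq0 : v != 0.
Proof. by rewrite -ht1 fmorph_eq0. Qed.

Let eK_neq0 : cst a * cst d - cst b * cst c != 0.
Proof.
by rewrite -!tofracM -tofracB -!mpolyCM -mpolyCB tofrac_eq0 mpolyC_eq0.
Qed.

Lemma jet_first : F 1 0 = cst a *: F 0 1 + cst c *: y.
Proof.
apply/colP=> i; rewrite comb2E (FE 1 0) (FE 0 1) yE /= mderiv_linsubst0.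
by rewrite comp_mpolyD !comp_mpolyZ -!mul_mpolyC tofracD !tofracM.
Qed.

Lemma jet_second : z = cst b *: F 0 1 + cst d *: y.
Proof.
apply/colP=> i; rewrite comb2E zE (FE 0 1) yE mderiv_linsubst1.
by rewrite comp_mpolyD !comp_mpolyZ -!mul_mpolyC tofracD !tofracM.
Qed.

Lemma iter_mderiv_homog l i : (l <= n)%N ->
  iter l (mderiv 0) (q i 0) \is (n - l).-homog.
Proof.
elim: l => [|l IH] ln; first by rewrite subn0; exact: qn.
by apply: mderiv_homog; rewrite subnSK //; exact: IH (ltnW ln).
Qed.

(** [iter_mderiv_linsubst] divided by v, for the column of all components. *)
Lemma jet_step k l : (0 < k + l <= 3)%N ->
  F k.+1 l = al *: F k l.+1 + (ga * (n%:R - (k + l)%:R)) *: F k l.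
Proof.
move=> /andP[_ kl]; have kln : (k + l <= n)%N by rewrite (leq_trans kl) // ltnW.
apply/colP=> i; rewrite comb2E (FE k.+1) (FE k l.+1) (FE k l).
set f := iter l _ _.
have df : f \is (k + (n - (k + l))).-homog.
  have -> : (k + (n - (k + l)) = n - l)%N.
    by rewrite -{2}(subnK kln) addnA addnK addnC.
  by rewrite iter_mderiv_homog // (leq_trans _ kln) // leq_addl.
have := congr1 (fun f => f%:F) (iter_mderiv_linsubst a b c d df).
rewrite tofracM tofrac_linform tofracD -!mul_mpolyC !tofracM -natrB //.
move=> E; apply: (mulfI v_neq0); rewrite E -/f.
rewrite mpolyCB !mpolyCM tofracB !tofracM.
have -> : cst (n - (k + l))%:R = (n - (k + l))%:R :> K.
  by rewrite -(rmorph_nat (@FracField.tofrac A)) mpolyC_nat.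
exact: (jet_step_field _ _ _ _ _ _ v_neq0).
Qed.

Let pderivF k : to_frac_col (pderiv Tq k 0) = F k 0.
Proof.
apply/colP=> i; rewrite FE /= mxE [X in X%:F]mxE /=.
by rewrite [in X in X%:F = _]mxE.
Qed.

Let h_pderivF l : map_mx h (to_frac_col (pderiv q l 0)) = F 0 l.
Proof.
by apply/colP=> i; rewrite FE /= mxE [X in h X]mxE hT; rewrite [in X in X%:F = _]mxE.
Qed.

Let h_pderivy : map_mx h (to_frac_col (pderiv q 0 1)) = y.
Proof.
by apply/colP=> i; rewrite yE /= mxE [X in h X]mxE hT; rewrite [in X in X%:F = _]mxE.
Qed.

Let frame_after : frame Tq = of_cols 4 [:: F 1 0; z; F 2 0; F 3 0].
Proof. by rewrite /frame /frame_cols !pderivF. Qed.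

Let frame_before : map_mx h (frame q) = of_cols 4 [:: F 0 1; y; F 0 2; F 0 3].
Proof.
have hcols c1 c2 c3 c4 : map_mx h (of_cols 4 [:: c1; c2; c3; c4]) =
    of_cols 4 [:: map_mx h c1; map_mx h c2; map_mx h c3; map_mx h c4] :> 'M_4.
  apply/matrixP=> i j; rewrite mxE [X in h X]mxE [RHS]mxE.
  by case: j => [[|[|[|[|]]]]] //= _; rewrite mxE.
by rewrite /frame /frame_cols hcols h_pderivy !h_pderivF.
Qed.

Let frame_change : frame Tq = map_mx h (frame q) *m
  jet_change n%:R (cst a) (cst b) (cst c) (cst d) (t0 R) (t1 R).
Proof.
rewrite frame_after frame_before; exact: (jet_frame jet_first jet_second jet_step).
Qed.

Let Delta_comp : (Delta Tq == 0) = (Delta q == 0).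
Proof.
rewrite -[LHS]tofrac_eq0 -[RHS]tofrac_eq0 -!det_frame frame_change det_mulmx.
rewrite det_map_mx mulf_eq0 fmorph_eq0.
have := jet_changeK n%:R eK_neq0 t1_neq0 v_neq0.
move=> /mulmx1_unit[]; rewrite unitmxE unitfE => /negbTE-> _.
by rewrite orbF.
Qed.

(** The frame of q(phi) is the image under h of the frame of q times an invertible
matrix, so the two frames degenerate together; otherwise their coordinates are
related by [jet_coords]. *)
Theorem kappa_linsubst : kappa1 n Tq = h (kappa1 n q) /\ kappa2 n Tq = h (kappa2 n q).
Proof.
have [D0|D0] := eqVneq (Delta q) 0.
  have [-> ->] := kappa_eq0 n D0; rewrite rmorph0.
  by apply: kappa_eq0; apply/eqP; rewrite Delta_comp D0.
have DT0 : Delta Tq != 0 by rewrite Delta_comp.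
have before : of_cols 4 [:: F 0 1; y; F 0 2; F 0 3] *m
    colvec 4 [:: h (I1 q); h (I2 q); h (I3 q); h (I4 q)] = F 0 4.
  rewrite -frame_before -h_pderivF -/(fourth_derivative q).
  rewrite -(frame_mul_coords D0) map_mxM; congr (_ *m _).
  apply/colP=> i; rewrite [RHS]mxE [X in _ = h X]mxE [LHS]mxE.
  by case: i => [[|[|[|[|]]]]].
have := jet_coords eK_neq0 jet_first jet_second jet_step before.
rewrite -frame_after -pderivF -/(fourth_derivative Tq).
move=> /(kappa_of_coords n DT0)[-> ->].
have [-> ->] := kappaE n q.
rewrite rmorph_curvature1 rmorph_curvature2 rmorph_nat ht0 ht1.
have k1 := curvature1_moved n%:R eK_neq0 t1_neq0 v_neq0
  (h (I1 q)) (h (I2 q)) (h (I3 q)) (h (I4 q)).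
have k2 := curvature2_moved n%:R eK_neq0 t1_neq0 v_neq0
  (h (I1 q)) (h (I2 q)) (h (I3 q)) (h (I4 q)).
by split; [exact: k1 | exact: k2].
Qed.

End Reparametrization.

(** * Divisibility by the Moebius-like factor *)

Lemma ord4_ind (P : 'I_4 -> Prop) :
  P 0 -> P 1 -> P 2%:R -> P 3%:R -> forall i, P i.
Proof.
move=> P0 P1 P2 P3 [[|[|[|[|//]]]] lt].
- by rewrite (_ : Ordinal lt = 0) //; apply: val_inj.
- by rewrite (_ : Ordinal lt = 1) //; apply: val_inj.
- by rewrite (_ : Ordinal lt = 2%:R) //; apply: val_inj.
- by rewrite (_ : Ordinal lt = 3%:R) //; apply: val_inj.
Qed.

Section MobiusDivides.
Variables (R : realType) (a b c d : R).
Local Notation e := (a * d - b * c).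
Hypothesis e0 : e != 0.
Local Notation A := {mpoly R[4]}.
Local Notation F := (mobius_like a b c d).
Let L0 : A := a *: 'X_0 + b *: 'X_1.
Let L1 : A := c *: 'X_0 + d *: 'X_1.
(** A substitution that kills L0, fixes L1 and is congruent to the identity
modulo L0: it detects the multiples of L0. *)
Let eps : 4.-tuple A := [tuple 'X_0 - (d / e) *: L0; 'X_1 + (c / e) *: L0; 'X_2; 'X_3].

Let eps_lin x y : (x *: 'X_0 + y *: 'X_1 : A) \mPo eps =
  x *: 'X_0 + y *: 'X_1 - ((x * d - y * c) / e) *: L0.
Proof.
rewrite comp_mpolyD !comp_mpolyZ !comp_mpolyXU /=.
move: L0 => l; rewrite scalerBr (scalerDr y) !scalerA addrACA -!scaleNr -scalerDl.
by congr (_ + _ *: _); field.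
Qed.

Let eps_L0 : L0 \mPo eps = 0.
Proof. by rewrite eps_lin divff // scale1r subrr. Qed.

Let eps_L1 : L1 \mPo eps = L1.
Proof. by rewrite eps_lin mulrC mulrC (mulrC d) subrr mul0r scale0r subr0. Qed.

Let linform4_neq0 x y x' y' :
  x * x' + y * y' != 0 -> (x *: 'X_0 + y *: 'X_1 : A) != 0.
Proof.
apply: contraNneq => l0.
have := congr1 (meval (fun i : 'I_4 => if i == 0 then x' else y')) l0.
by rewrite mevalD !mevalZ !mevalXU meval0 /= => ->.
Qed.

Let L1_neq0 : L1 != 0.
Proof. by apply: (@linform4_neq0 _ _ (- b) a); rewrite mulrN addrC mulrC (mulrC c). Qed.

Let L0_neq0 : L0 != 0.
Proof. by apply: (@linform4_neq0 _ _ d (- c)); rewrite mulrN. Qed.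

(** Modulo L0 the factor F becomes u L1, which is not a zero divisor; so if L0 f is
a multiple k F, then L0 divides k. *)
Lemma mobius_cancel (f : A) : mdvd F (L0 * f) -> mdvd F f.
Proof.
move=> [k E].
have /eqP := congr1 (comp_mpoly eps) E.
rewrite rmorphM /= eps_L0 mul0r rmorphM /= rmorphB !rmorphM /= eps_L0 eps_L1.
rewrite mulr0 subr0 comp_mpolyXU /= eq_sym !mulf_eq0 (negbTE L1_neq0) orbF.
rewrite -[X in _ || X]msize_poly_eq0 msizeX orbF => /eqP k0.
have [|z Ez] := @mmap_congr 4 R A L0 (@mpolyC 4 R) (fun i => 'X_i) (tnth eps) k.
  elim/ord4_ind; rewrite (tnth_nth 0) /=.
  - by exists (d / e)%:MP; rewrite opprB addrC subrK mul_mpolyC.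
  - by exists (- (c / e))%:MP; rewrite opprD addNKr mul_mpolyC scaleNr.
  - by exists 0; rewrite subrr mul0r.
  - by exists 0; rewrite subrr mul0r.
have kz : k = z * L0.
  move: Ez; rewrite -/(comp_mpoly eps k) k0 subr0 => <-.
  rewrite -[LHS]comp_mpoly_id; apply: eq_bigr => m _; congr (_ * _).
  by apply: mmap1_eq => i; rewrite tnth_mktuple.
by exists z; apply: (mulfI L0_neq0); rewrite E kz mulrAC mulrC.
Qed.

(** Modulo F the vectors L0 (u, v) and u (L0, L1) agree, whence
L0^m h(u, v) = u^m h(L0, L1) for every form h of degree m.  So F divides
L0^m E, and L0 can be cancelled. *)
Lemma mobius_dvd m (f g U V : {mpoly R[2]}) :
    f \is m.-homog -> g \is m.-homog ->
    U * (g \mPo linsubst a b c d) = V * (f \mPo linsubst a b c d) ->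
  mdvd F (E_poly U V f g).
Proof.
move=> fm gm UV.
have cong (h : {mpoly R[2]}) : h \is m.-homog ->
    exists z, L0 ^+ m * in_uv h - 'X_2 ^+ m * in_t (h \mPo linsubst a b c d) = z * F.
  move=> hm; rewrite /in_t /in_uv /comp_mpoly mmap_comp_mpoly.
  pose uv i : A := L0 * tnth [tuple 'X_2; 'X_3] i.
  rewrite -(@mmap_homog _ _ _ _ _ uv L0 _ _ hm) // /uv.
  pose L i : {mpoly R[4]} := tnth (linsubst a b c d) i \mPo [tuple 'X_0; 'X_1].
  rewrite -(mmap_homog (h' := fun i => 'X_2 * L i) _ hm) // /L.
  (* u * (L0, L1) and L0 * (u, v) agree in the first entry, and differ by F in
     the second one *)
  apply: mmap_congr; elim/ord2_ind; rewrite !(tnth_nth 0);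
    rewrite /= linform_comp !(tnth_nth 0) /= -/L0 -/L1.
    by exists 0; rewrite mulrC subrr mul0r.
  by exists (-1); rewrite mulN1r opprB /mobius_like -/L0 -/L1 (mulrC L0).
have [z Ez] := cong g gm; have [z' Ez'] := cong f fm.
suff : mdvd F (L0 ^+ m * E_poly U V f g).
  elim: (m) => [|k IH]; first by rewrite mul1r.
  by rewrite exprS -mulrA => /mobius_cancel.
exists (in_t U * z - in_t V * z').
have : in_t U * in_t (g \mPo linsubst a b c d) =
    in_t V * in_t (f \mPo linsubst a b c d).
  by rewrite /in_t -!rmorphM UV.
rewrite mulrBl -!mulrA -Ez -Ez' /E_poly.
move: (in_t U) (in_t V) (in_t (g \mPo _)) (in_t (f \mPo _)) (in_uv g) (in_uv f).
move: (L0 ^+ m) ('X_2 ^+ m) => l x u v g' f' g2 f2 E.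
rewrite !mulrBr (mulrCA u x) (mulrCA v x) E !(mulrCA l).
by rewrite opprB addrA subrK.
Qed.
End MobiusDivides.

Section CurvatureQuotients.
Variable R : realType.
Local Notation A := {mpoly R[2]}.
Local Notation K := {fraction A}.
Local Notation "x %:F" := (@FracField.tofrac _ x).

(** Homogeneity of degree 0, tested on the scaling by 2 only, which is a special
case of the linear substitutions already treated. *)
Definition scaling_invariant (k : K) : Prop :=
  exists2 h : {rmorphism K -> K},
    forall f : A, h f%:F = (f \mPo linsubst 2 0 0 2)%:F & h k = k.

Lemma comp_scaling m (f : A) : f \is m.-homog ->
  f \mPo linsubst 2 0 0 2 = 2 ^+ m *: f.
Proof.
move=> fm; rewrite /comp_mpoly (mmap_homog (h := fun i => 'X_i) (z := 2) _ fm).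
  rewrite -[in RHS](comp_mpoly_id f) -mul_mpolyC rmorphXn /=.
  congr (_ ^+ _ * _); first by rewrite -mpolyC_nat.
  by apply: eq_bigr => i _; congr (_ * _); apply: mmap1_eq => j; rewrite tnth_mktuple.
elim/ord2_ind; rewrite (tnth_nth 0) /= /linform scale0r ?addr0 ?add0r;
  by rewrite scaler_nat mulr_natl.
Qed.

(** Doubling the parameters multiplies q by the constant 2^n. *)
Lemma kappa_scaling_invariant n (q : 'cV[A]_4) : (3 < n)%N ->
    homogeneous_param n q ->
  scaling_invariant (kappa1 n q) /\ scaling_invariant (kappa2 n q).
Proof.
move=> n3 qn.
have e0 : 2 * 2 - 0 * 0 != 0 :> R by rewrite mulr0 subr0 mulf_neq0 ?pnatr_eq0.
have [h hT] := frac_extension (linsubst_inj e0).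
have [] := kappa_linsubst n3 qn e0 hT.
have -> : map_mx (comp_mpoly (linsubst 2 0 0 2)) q =
    map_mx (@mpolyC 2 R) (2 ^+ n)%:M *m q.
  apply/colP=> i; rewrite map_scalar_mx mul_scalar_mx !mxE.
  by rewrite (comp_scaling (qn i)) mul_mpolyC.
have u2 : ((2 ^+ n)%:M : 'M[R]_4) \in unitmx.
  by rewrite unitmxE det_scalar unitrX // unitrX // unitfE pnatr_eq0.
have [-> ->] := kappa_mulmx n q u2.
by split; exists h.
Qed.

(** If U and V have degrees i and j, the scaling by 2 multiplies U / V by 2^(i - j). *)
Lemma lowest_terms_degree (k : K) (U V : A) : scaling_invariant k ->
  lowest_terms k U V -> U != 0 -> exists m, U \is m.-homog /\ V \is m.-homog.
Proof.
move=> [h hT hk] [[i Ui] [j Vj] V0 _ kE] U0.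
have VF0 : V%:F != 0 by rewrite tofrac_eq0.
have two_neq0 m : 2 ^+ m != 0 :> R by rewrite expf_neq0 // pnatr_eq0.
have /eqP : h (U%:F / V%:F) = U%:F / V%:F by rewrite -kE.
rewrite fmorph_div /= !hT (comp_scaling Ui) (comp_scaling Vj).
have sV0 : (2 ^+ j *: V)%:F != 0 by rewrite tofrac_eq0 scaler_eq0 negb_or two_neq0.
rewrite (eqr_div _ _ sV0 VF0).
rewrite -!tofracM tofrac_eq -scalerAl -scalerAr.
rewrite -subr_eq0 -scalerBl scaler_eq0 mulf_eq0 (negbTE U0) (negbTE V0) !orbF subr_eq0.
rewrite -!natrX eqr_nat eqn_exp2l // => /eqP ij.
by exists i; split; rewrite // ij.
Qed.

Lemma mobius_dvd_quotients (a b c d : R) (k l : K) (U V Ub Vb : A)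
    (h : {rmorphism K -> K}) : a * d - b * c != 0 ->
    (forall f : A, h f%:F = (f \mPo linsubst a b c d)%:F) -> k = h l ->
    scaling_invariant l ->
    lowest_terms k U V -> lowest_terms l Ub Vb ->
  mdvd (mobius_like a b c d) (E_poly U V Ub Vb).
Proof.
move=> e0 hT kl inv [_ _ V0 _ kE] low.
have [_ _ Vb0 _ lE] := low.
have TVb0 : Vb \mPo linsubst a b c d != 0.
  by rewrite -(comp_mpoly0 (linsubst a b c d)) (inj_eq (linsubst_inj e0)).
have UV : U * (Vb \mPo linsubst a b c d) = V * (Ub \mPo linsubst a b c d).
  have /eqP : U%:F / V%:F = h (Ub%:F / Vb%:F) by rewrite -kE -lE.
  have VF0 : V%:F != 0 by rewrite tofrac_eq0.
  have TVF0 : (Vb \mPo linsubst a b c d)%:F != 0 by rewrite tofrac_eq0.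
  rewrite fmorph_div /= !hT (eqr_div _ _ VF0 TVF0) -!tofracM tofrac_eq.
  by move=> /eqP->; rewrite mulrC.
(* the zero fraction has no well-defined degree, but then U = 0 as well *)
have [Ub0|Ub0] := eqVneq Ub 0; last first.
  have [m [Um Vm]] := lowest_terms_degree inv low Ub0.
  exact: (mobius_dvd e0 Um Vm UV).
move/eqP: UV; rewrite Ub0 comp_mpoly0 mulr0 mulf_eq0 (negbTE TVb0) orbF => /eqP ->.
by exists 0; rewrite /E_poly /in_t /in_uv !comp_mpoly0 mulr0 !mul0r subr0.
Qed.

End CurvatureQuotients.

(** * Projectively equivalent curves *)

Theorem theorem12 (R : realType) (n : nat)
    (C1 C2 : 'cV[R]_4 -> Prop) (p q : 'cV[{mpoly R[2]}]_4)
    (U V Y Z Ub Vb Yb Zb : {mpoly R[2]}) (G : {mpoly R[4]}) :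
  (4 <= n)%N ->
  homogeneous_param n p -> homogeneous_param n q ->
  birational_onto p C1 -> birational_onto q C2 ->
  is_gcd [seq p i 0 | i : 'I_4] 1 -> is_gcd [seq q i 0 | i : 'I_4] 1 ->
  ~ in_hyperplane C1 -> ~ in_hyperplane C2 ->
  lowest_terms (kappa1 n p) U V -> lowest_terms (kappa2 n p) Y Z ->
  lowest_terms (kappa1 n q) Ub Vb -> lowest_terms (kappa2 n q) Yb Zb ->
  is_gcd [:: E_poly U V Ub Vb; E_poly Y Z Yb Zb] G ->
  projectively_equivalent C1 C2 ->
  exists a b c d : R, a * d - b * c != 0 /\ mdvd (mobius_like a b c d) G.
Proof.
move=> n4 pn qn pC qC p1 q1 _ _ UV YZ UVb YZb [_ G_max] [M uM CM].
have n_gt0 : (0 < n)%N by apply: leq_trans n4.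
have [a [b [c [d [lam [e0 lam0 E]]]]]] :=
  reparametrization_of_equivalence n_gt0 pn qn pC qC p1 q1 uM CM.
have [h hT] := frac_extension (linsubst_inj e0).
have [inv1 inv2] := kappa_scaling_invariant n4 qn.
have ulam : (lam%:M : 'M[R]_4) \in unitmx.
  by rewrite unitmxE det_scalar unitrX // unitfE.
have [k1 k2] : kappa1 n p = h (kappa1 n q) /\ kappa2 n p = h (kappa2 n q).
  have [<- <-] := kappa_linsubst n4 qn e0 hT.
  have [<- <-] := kappa_mulmx n p uM; rewrite E; exact: kappa_mulmx.
exists a, b, c, d; split=> //; apply: G_max => f.
rewrite !inE => /orP[] /eqP ->.
  exact: mobius_dvd_quotients e0 hT k1 inv1 UV UVb.
exact: mobius_dvd_quotients e0 hT k2 inv2 YZ YZb.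
Qed.
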